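(* Let $G$ be a graph of connectivity 1 without pendant edges, with maximum degree $\Delta$. Then $$M'_D(G) \leq \lceil \sqrt{\Delta} \rceil + 5.$$
   Context: Graphs are finite, simple and undirected. A pendant edge is an edge incident with a vertex of degree one. A majority edge coloring is an edge coloring such that for every vertex $u$ and every color $\alpha$, at most half of the edges incident with $u$ have color $\alpha$. It is distinguishing if the only automorphism $\varphi$ of $G$ with $c(\varphi(u)\varphi(v))=c(uv)$ for all edges $uv$ is the identity. $M'_D(G)$ is the least number of colors in an edge coloring of $G$ that is both majority and distinguishing. *)

(* Defs.v *)
From mathcomp Require Import all_boot all_order all_fingroup all_algebra.

Set Implicit Arguments.
Unset Strict Implicit.
Unset Printing Implicit Defensive.

(* A finite simple graph on the vertex set [T] is a symmetric
   irreflexive relation [e : rel T]; edges are two-element vertex sets. *)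

Section Graph.

Variables (T : finType) (e : rel T).

Definition edges : {set {set T}} :=
  [set [set p.1; p.2] | p : T * T & e p.1 p.2].

Definition incident (u : T) : {set {set T}} := [set f in edges | u \in f].

Definition degree (u : T) : nat := #|incident u|.

Definition max_degree : nat := \max_(u : T) degree u.

Definition pendant (f : {set T}) : bool :=
  (f \in edges) && [exists u in f, degree u == 1].

Definition del_vertices (S : {set T}) : rel T :=
  [rel x y | [&& x \notin S, y \notin S & e x y]].

Definition disconnects (S : {set T}) : bool :=
  [exists x in ~: S, exists y in ~: S, ~~ connect (del_vertices S) x y].

(* The clause on [#|~: S|] gives K_n connectivity n - 1, and makes [setT] a
   valid default for the minimum below. *)
Definition vertex_connectivity : nat :=
  #|[arg min_(S < [set: T] | disconnects S || (#|~: S| <= 1)) #|S| ]|.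

(* An edge coloring is the restriction to [edges] of [c : {set T} -> nat];
   its values on other vertex sets are irrelevant. *)

Definition majority (c : {set T} -> nat) : Prop :=
  forall (u : T) (a : nat),
    2 * #|[set f in incident u | c f == a]| <= #|incident u|.

Definition automorphism (phi : {perm T}) : Prop :=
  forall u v : T, e (phi u) (phi v) = e u v.

Definition distinguishing (c : {set T} -> nat) : Prop :=
  forall phi : {perm T},
    automorphism phi ->
    (forall u v : T, e u v -> c [set phi u; phi v] = c [set u; v]) ->
    phi = 1%g.

Definition MD_colorable (k : nat) : Prop :=
  exists c : {set T} -> nat,
    [/\ {in edges, forall f, c f < k}, majority c & distinguishing c].

(* [is_MD m] says that M'_D is defined and equal to [m]; it is a relation
   because a graph with a pendant edge has no majority edge coloring. *)
Definition is_MD (m : nat) : Prop :=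
  MD_colorable m /\ forall k : nat, MD_colorable k -> m <= k.

End Graph.

(* Main.v *)
(** Let s^2 >= Delta. Color the edges one at a time. At a vertex of degree d at
    most two colors occur floor(d/2) times among the other edges, so the majority
    condition forbids at most four colors for an edge, and among s + 5 colors
    there remain, besides color 0, at least s for breaking symmetries.

    If Delta >= 4, color 0 is used on exactly two edges, both at a vertex r of
    degree at least 4, so r is fixed; then the distance levels from r are fixed
    one after another. Vertices with the same neighbors one level below (twins) are
    divided by the color of the edge to their first lower neighbor into groups
    of at most s. Inside a group, vertices with several lower neighbors are
    told apart by the edge to the second one, and vertices with a single lower
    neighbor by the palette of their upward edges. A vertex with a single lower
    neighbor and no upper one (flat) only has further neighbors in its own level.
    A component of the graph on the flat vertices is recognized by the palette of
    the edges meeting it, its root by its color, and the other vertices by a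
    breadth-first search from the root. The order of the edges makes each of
    these requirements forbid at most s - 1 colors for the edge that decides it.

    If Delta <= 3, take a proper coloring with a single edge rb of color 0 such
    that r and b have different palettes. Then r is fixed, and every vertex
    adjacent to a fixed one is fixed. *)

From Stdlib Require Import Classical.
Require Import Defs.
From mathcomp Require Import all_boot all_order all_fingroup all_algebra.
From mathcomp Require Import reals.
From mathcomp Require Import zify.

Set Implicit Arguments.
Unset Strict Implicit.
Unset Printing Implicit Defensive.

(** * Bounds on sets of forbidden colors, and greedy coloring *)

Definition few (k : nat) (F : nat -> Prop) : Prop :=
  exists2 l : seq nat, size l <= k & forall a, F a -> a \in l.

Lemma few0 k (F : nat -> Prop) : (forall a, ~ F a) -> few k F.
Proof. by move=> nF; exists [::] => // a /nF. Qed.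

Lemma few_sub k k' (F G : nat -> Prop) :
  k <= k' -> (forall a, F a -> G a) -> few k G -> few k' F.
Proof.
move=> le_kk' FG [l sz_l Gl]; exists l; first exact: leq_trans le_kk'.
by move=> a /FG /Gl.
Qed.

Lemma few_or k k' (F G : nat -> Prop) :
  few k F -> few k' G -> few (k + k') (fun a => F a \/ G a).
Proof.
move=> [l sz_l Fl] [l' sz_l' Gl]; exists (l ++ l'); first by rewrite size_cat leq_add.
by move=> a [/Fl|/Gl] al; rewrite mem_cat al ?orbT.
Qed.

Lemma few_seq k (l : seq nat) (F : nat -> Prop) :
  size l <= k -> (forall a, F a -> a \in l) -> few k F.
Proof. by move=> *; exists l. Qed.

(** Each element of [X] contributes at most one color; whether it contributes any is decided
    classically, [P] being a mere proposition. *)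
Lemma few_image (T : finType) (X : {set T}) (P : T -> nat -> Prop) k :
  #|X| <= k -> (forall x a b, P x a -> P x b -> a = b) ->
  few k (fun a => exists2 x, x \in X & P x a).
Proof.
move=> leXk funP.
suff [l sz_l Pl] : exists2 l : seq nat, size l <= size (enum X) &
    forall a x, x \in enum X -> P x a -> a \in l.
  exists l => [|a [x xX Pxa]]; first by rewrite (leq_trans sz_l) -?cardE.
  by apply: Pl Pxa; rewrite mem_enum.
elim: (enum X) => [|x s [l sz_l Pl]]; first by exists [::].
case: (classic (exists a, P x a)) => [[a Pxa]|nP].
  exists (a :: l) => // b y; rewrite !inE => /orP[/eqP-> Pxb|ys Pyb].
    by rewrite (funP _ _ _ Pxa Pxb) eqxx.
  by rewrite (Pl _ _ ys Pyb) orbT.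
exists l => [|b y]; first exact: leqW.
rewrite inE => /orP[/eqP-> Pxb|]; last exact: Pl.
by case: nP; exists b.
Qed.

Lemma few_avoid k n (F : nat -> Prop) :
  few k F -> k < n -> exists2 a, a < n & ~ F a.
Proof.
move=> [l sz_l Fl] lt_kn; have : ~~ all (mem l) (iota 0 n).
  apply/negP => /allP sub; have := uniq_leq_size (iota_uniq 0 n) sub.
  by rewrite size_iota leqNgt (leq_ltn_trans sz_l).
case/allPn => a; rewrite mem_iota => /= lt_an al; exists a => // /Fl.
by apply/negP.
Qed.


Lemma sum_card_fiber (E : finType) (c : E -> nat) (l : seq nat) (L : {set E}) :
  uniq l -> \sum_(a <- l) #|[set g in L | c g == a]| <= #|L|.
Proof.
elim: l L => [|a l IHl] L /=; first by rewrite big_nil.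
move=> /andP[al ul]; rewrite big_cons; set S := [set g in L | c g == a].
have SL : S \subset L by apply/subsetP => g; rewrite inE => /andP[].
rewrite -(cardsID S L) (setIidPr SL) leq_add2l.
apply: leq_trans (IHl (L :\: S) ul).
rewrite !big_seq; apply: leq_sum => b bl; apply/subset_leq_card/subsetP => g.
rewrite !inE => /andP[-> /eqP cb]; rewrite cb eqxx !andbT /=.
by apply: contraNneq al => <-.
Qed.

(** Color classes are disjoint, so [k + 1] colors of frequency at least [t] would need [t * (k + 1)]
    elements. *)
Lemma few_frequent (E : finType) (L : {set E}) (c : E -> nat) t k :
  #|L| < t * k.+1 ->
  few k (fun a => t <= #|[set g in L | c g == a]|).
Proof.
move=> ltL; have t_gt0 : 0 < t by case: (t) ltL.
pose l := [seq a <- undup [seq c g | g in L] | t <= #|[set g in L | c g == a]|].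
exists l => [|a ta]; last first.
  rewrite mem_filter ta mem_undup.
  have /card_gt0P[g] := leq_trans t_gt0 ta.
  by rewrite inE => /andP[gL /eqP <-]; apply: map_f; rewrite mem_enum.
have ul : uniq l by rewrite filter_uniq ?undup_uniq.
have : size l * t <= #|L|.
  apply: leq_trans (sum_card_fiber c L ul).
  rewrite -sum1_size big_distrl /= !big_seq leq_sum // => a.
  by rewrite mem_filter mul1n => /andP[].
by move=> /leq_ltn_trans/(_ ltL); rewrite mulnC ltn_pmul2l.
Qed.

(* A last edge can complete a given multiset of colors in at most one way. *)
Lemma count_shift_inj (n m : nat -> nat) a b :
  (forall x, n x + (a == x) = m x) -> (forall x, n x + (b == x) = m x) -> a = b.
Proof.
move=> Ha Hb; apply/eqP; have := Hb a; rewrite -(Ha a) eqxx.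
by rewrite eq_sym => /addnI; case: eqP.
Qed.

Lemma eq_card_in (E : finType) (A : {set E}) (P Q : pred E) :
  {in A, P =1 Q} -> #|[set x in A | P x]| = #|[set x in A | Q x]|.
Proof.
by move=> PQ; apply: eq_card => x; rewrite !inE; case xA: (x \in A); rewrite //= PQ.
Qed.

(** Colors are chosen by increasing [rank]. The rule at [f] reads only earlier colors ([local]), so
    a choice that was legal when made stays legal. *)
Lemma greedy_coloring (E : finType) (rank : E -> nat) N
    (rule : E -> (E -> nat) -> nat -> Prop) :
  injective rank ->
  (forall f c c' a, (forall g, rank g < rank f -> c g = c' g) ->
     rule f c a -> rule f c' a) ->
  (forall f c, (forall g, rank g < rank f -> c g < N /\ ~ rule g c (c g)) ->
     exists2 a, a < N & ~ rule f c a) ->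
  exists c, forall f, c f < N /\ ~ rule f c (c f).
Proof.
move=> rank_inj local choice.
suff H m : exists c, forall f, rank f < m -> c f < N /\ ~ rule f c (c f).
  have [c Hc] := H (\max_f rank f).+1; exists c => f; apply: Hc.
  by rewrite ltnS leq_bigmax.
elim: m => [|m [c IHc]]; first by exists (fun => 0).
case: (pickP (fun f => rank f == m)) => [f /eqP rf|no_f]; last first.
  exists c => f; rewrite ltnS leq_eqVlt (no_f f) /=; exact: IHc.
have [|a ltaN na] := choice f c; first by rewrite rf.
pose c' g := if g == f then a else c g.
have cc' g : rank g < m -> c g = c' g.
  by rewrite /c'; case: eqP => // ->; rewrite rf ltnn.
exists c' => g; rewrite ltnS leq_eqVlt => /orP[/eqP rg|ltg].
  have -> : g = f by apply: rank_inj; rewrite rf.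
  rewrite {1 3}/c' eqxx; split=> // rul; apply: na.
  by apply: local rul => h; rewrite rf => /cc'.
rewrite -(cc' g ltg); have [ltN nr] := IHc g ltg; split=> // rul; apply: nr.
by apply: local rul => h lth; rewrite cc' // (ltn_trans lth).
Qed.

Lemma lex_lt n a b a' b' : b < n -> a < a' -> a * n + b < a' * n + b'.
Proof. nia. Qed.

(** * Distance by growing balls *)

Section Distance.

Variables (T : finType) (R : rel T).

Definition ball (a : T) (n : nat) : {set T} :=
  iter n (fun S => S :|: [set y | [exists x in S, R x y]]) [set a].

(** Shortest paths have fewer than [#|T|] edges, so the search may stop there; on unreachable
    vertices the value is [#|T|]. *)
Definition dist (a b : T) : nat := find (fun n => b \in ball a n) (iota 0 #|T|).

Lemma ballS a n y : (y \in ball a n.+1) = (y \in ball a n) || [exists x in ball a n, R x y].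
Proof. by rewrite /ball iterS !inE. Qed.

Lemma mem_ball_path a p : path R a p -> last a p \in ball a (size p).
Proof.
elim/last_ind: p => [|p y IHp]; first by rewrite inE.
rewrite rcons_path last_rcons size_rcons => /andP[/IHp py Ry].
by rewrite ballS; apply/orP; right; apply/existsP; exists (last a p); rewrite py.
Qed.

Lemma connect_ball a n y : y \in ball a n -> connect R a y.
Proof.
elim: n y => [|n IHn] y; first by rewrite inE => /eqP ->.
rewrite ballS => /orP[/IHn //|/existsP[x /andP[/IHn ax Rxy]]].
exact: connect_trans ax (connect1 Rxy).
Qed.

Lemma has_ball a b : connect R a b -> has (fun n => b \in ball a n) (iota 0 #|T|).
Proof.
case/connectP => p0 /shortenP[p Rp up _] ->; apply/hasP; exists (size p).
  by rewrite mem_iota /= -ltnS -[(size p).+1]/(size (a :: p)) ltnS -(card_uniqP up) max_card.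
exact: mem_ball_path.
Qed.

Lemma dist_lt a b : connect R a b -> dist a b < #|T|.
Proof. by move=> /has_ball; rewrite has_find size_iota. Qed.

Lemma ball_dist a b : connect R a b -> b \in ball a (dist a b).
Proof.
move=> ab; have := nth_find 0 (has_ball ab).
by rewrite nth_iota ?add0n // dist_lt.
Qed.

Lemma dist_le a b n : b \in ball a n -> dist a b <= n.
Proof.
move=> bn; rewrite leqNgt; apply/negP => lt_n.
have := before_find 0 lt_n; rewrite nth_iota ?add0n ?bn //.
exact: ltn_trans lt_n (dist_lt (connect_ball bn)).
Qed.

Lemma dist0 a : dist a a = 0.
Proof. by apply/eqP; rewrite -leqn0 dist_le ?inE. Qed.

Lemma dist_eq0 a b : connect R a b -> dist a b = 0 -> b = a.
Proof. by move=> /ball_dist + d0; rewrite d0 inE => /eqP. Qed.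

Lemma dist_step a x y : connect R a x -> R x y -> dist a y <= (dist a x).+1.
Proof.
move=> /ball_dist xb Rxy; apply: dist_le; rewrite ballS.
by apply/orP; right; apply/existsP; exists x; rewrite xb.
Qed.

Lemma dist_pred a y : connect R a y -> y != a ->
  exists x, [/\ connect R a x, R x y & dist a y = (dist a x).+1].
Proof.
move=> ay nya; have := ball_dist ay; case dy: (dist a y) => [|n].
  by rewrite (dist_eq0 ay dy) eqxx in nya.
rewrite ballS => /orP[/dist_le|/existsP[x /andP[xn Rxy]]]; first by rewrite dy ltnn.
have ax := connect_ball xn; exists x; split=> //; congr _.+1.
have := dist_le xn; have := dist_step ax Rxy; rewrite dy; lia.
Qed.

Lemma ball_perm (phi : {perm T}) a n y :
  (forall x y, R (phi x) (phi y) = R x y) ->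
  (phi y \in ball (phi a) n) = (y \in ball a n).
Proof.
move=> Rphi; elim: n y => [|n IHn] y; first by rewrite !inE (inj_eq perm_inj).
rewrite !ballS IHn; congr (_ || _); apply/existsP/existsP => -[x /andP[xb Rx]].
  by exists ((phi^-1)%g x); rewrite -IHn permKV xb -Rphi permKV.
by exists (phi x); rewrite IHn xb Rphi.
Qed.

Lemma dist_perm (phi : {perm T}) a b :
  (forall x y, R (phi x) (phi y) = R x y) -> dist (phi a) (phi b) = dist a b.
Proof. by move=> Rphi; apply: eq_find => n; rewrite ball_perm. Qed.

Lemma connect_perm (phi : {perm T}) a b :
  (forall x y, R (phi x) (phi y) = R x y) -> connect R (phi a) (phi b) = connect R a b.
Proof.
move=> Rphi; apply/idP/idP => [ab|].
  have := ball_dist ab; rewrite ball_perm //; exact: connect_ball.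
by move=> /ball_dist; rewrite -(ball_perm _ _ _ Rphi); exact: connect_ball.
Qed.

End Distance.

(** * Edges as two-element sets *)

Section Basics.

Variables (T : finType) (e : rel T).
Hypotheses (e_sym : symmetric e) (e_irr : irreflexive e).

Lemma edgesP f : reflect (exists x y, e x y /\ f = [set x; y]) (f \in edges e).
Proof.
apply: (iffP imsetP) => [[[x y]]|[x [y [exy ->]]]].
  by rewrite inE /= => exy ->; exists x, y.
by exists (x, y); rewrite ?inE.
Qed.

Lemma mem_edges x y : e x y -> [set x; y] \in edges e.
Proof. by move=> exy; apply/edgesP; exists x, y. Qed.

Lemma mem_edgesE x y : ([set x; y] \in edges e) = e x y.
Proof.
apply/idP/idP; last exact: mem_edges.
case/edgesP => u [v [euv]] /setP eqf.
have := eqf x; have := eqf y; have := eqf u; have := eqf v; rewrite !inE !eqxx !orbT /=.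
have nuv : u != v by apply: contraTneq euv => ->; rewrite e_irr.
move=> /orP[]/eqP Hv /orP[]/eqP Hu _ _; move: nuv euv; subst u v; rewrite ?eqxx // => _ //.
by rewrite e_sym.
Qed.

Lemma set2C (x y : T) : [set x; y] = [set y; x].
Proof. exact: setUC. Qed.

Lemma set2_inj (u x y : T) : [set u; x] = [set u; y] -> x = y.
Proof.
move=> /setP eqf; have := eqf x; have := eqf y; rewrite !inE !eqxx !orbT.
by move=> /orP[]/eqP-> // /esym/orP[]/eqP.
Qed.

Lemma incidentP u f : reflect (exists2 x, e u x & f = [set u; x]) (f \in incident e u).
Proof.
rewrite inE; apply: (iffP andP) => [[/edgesP[x [y [exy ->]]]]|[x eux ->]].
  rewrite !inE => /orP[]/eqP->; first by exists y.
  by exists x; rewrite ?(e_sym y) // set2C.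
by rewrite mem_edges // !inE eqxx.
Qed.

Lemma degreeE u : degree e u = #|[set x | e u x]|.
Proof.
rewrite /degree -(card_imset _ (@set2_inj u)); apply: eq_card => f.
apply/incidentP/imsetP => -[x Hx ->]; exists x => //; move: Hx; by rewrite inE.
Qed.

Lemma incident_edge u f : f \in incident e u -> f \in edges e.
Proof. by rewrite inE => /andP[]. Qed.

Lemma mem_incident u x : e u x -> [set u; x] \in incident e u.
Proof. by move=> eux; apply/incidentP; exists x. Qed.

Lemma degree_le_max u : degree e u <= max_degree e.
Proof. exact: leq_bigmax. Qed.

End Basics.

(** * Levels, twins, flat components and the order of the edges *)

Section Layers.

Variables (T : finType) (e : rel T) (r : T).
Hypotheses (e_sym : symmetric e) (e_irr : irreflexive e).
Hypothesis conn : forall x y, connect e x y.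
Hypothesis deg2 : forall u, 2 <= degree e u.

Definition depth (v : T) : nat := dist e r v.
Local Notation d := depth.

Definition below (w : T) : {set T} := [set v | e v w & (d v).+1 == d w].
Definition above (v : T) : {set T} := [set w | e v w & d w == (d v).+1].
Definition lone (w : T) : bool := #|below w| == 1.

Definition flat (w : T) : bool := lone w && (above w == set0).
Definition flat_adj : rel T := [rel x y | [&& flat x, flat y & e x y]].
Definition flat_root (x : T) : T := fingraph.root flat_adj x.
Definition side_nbr (u : T) : T := odflt u [pick z | e u z && (d z == d u)].
Definition twin_rep (w : T) : T := odflt w [pick w' | below w' == below w].

(* A marked vertex is the only one among the twins it has to be told apart from
   ([separated]) whose first downward edge has its color. *)
Definition marked (w : T) : bool :=
  if lone w then flat w && ((w == flat_root w) || (w == side_nbr (flat_root w)))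
  else w == twin_rep w.

(** Only pairs with a marked member are listed, so that a vertex has at most two marked partners
    ([marked_separated]). *)
Definition separated (w w' : T) : bool :=
  [&& w' != w, below w' == below w,
      lone w ==> [&& flat w, flat w' & connect flat_adj w w']
    & marked w || marked w'].

Definition bfs_rank (v : T) : nat := d v * #|T| + enum_rank v.
Local Notation rho := bfs_rank.

(* [first_of] and [last_of] take the value [r] on the empty set. *)
Definition first_of (S : {set T}) : T :=
  odflt r [pick v in S | [forall u in S, rho v <= rho u]].
Definition last_of (S : {set T}) : T :=
  odflt r [pick v in S | [forall u in S, rho u <= rho v]].

Definition par1 (w : T) : T := first_of (below w).
Definition par2 (w : T) : T := first_of (below w :\ par1 w).

(* The edge from [v] to [star v] is the last upward edge of [v] to be colored and
   decides the palette of [v]. It is chosen such that this does not interfere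
   with telling twins apart: see [star_marked] and [star_par2]. *)
Definition star (v : T) : T :=
  let w0 := odflt v [pick w in above v] in
  if v == par1 w0 then odflt w0 [pick w | (below w == below w0) && ~~ marked w]
  else if v == par2 w0 then twin_rep w0 else w0.

(* For the root [u] of a component of flat vertices, the edge that is colored
   last and decides the palette of the whole component. *)
Definition closing (u : T) : {set T} := [set u; side_nbr u].
Definition is_closing (f : {set T}) : bool :=
  [exists u, [&& flat u, flat_root u == u & f == closing u]].

(** Edges inside a level wait for all upward edges, which decide the groups of twins. Closing edges
    wait for all others, so that each completes the palette of its component. *)
Definition tier (f : {set T}) : nat :=
  if last_of f \in above (first_of f) then 0 else if is_closing f then 2 else 1.

(* Upward edges come first, by increasing lower end; among those of [v] the
   edges to marked vertices come first and the one to [star v] comes last. *)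
Definition edge_rank (f : {set T}) : nat :=
  let v := first_of f in let w := last_of f in
  (((tier f * (\max_x rho x).+1 + rho v) * 2 + (star v == w)) * 2
    + ~~ marked w) * #|{set T}| + enum_rank f.
Definition earlier (g f : {set T}) : bool := edge_rank g < edge_rank f.

Lemma depth_root : d r = 0. Proof. exact: dist0. Qed.

Lemma depth_eq0 v : d v = 0 -> v = r.
Proof. exact: dist_eq0. Qed.

Lemma depth_adj x y : e x y -> d y <= (d x).+1.
Proof. exact: dist_step. Qed.

Lemma mem_above v w : (w \in above v) = (v \in below w).
Proof. by rewrite !inE eq_sym. Qed.

Lemma above_adj v w : w \in above v -> e v w.
Proof. by rewrite inE => /andP[]. Qed.

Lemma above_depth v w : w \in above v -> d w = (d v).+1.
Proof. by rewrite inE => /andP[_ /eqP]. Qed.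

Lemma above_neq_root v w : w \in above v -> w != r.
Proof. by move=> /above_depth dw; apply: contra_eq_neq dw => ->; rewrite depth_root. Qed.

Variant adj_spec x y : Prop :=
| AdjUp of y \in above x
| AdjDown of x \in above y
| AdjSide of d x = d y.

Lemma adjP x y : e x y -> adj_spec x y.
Proof.
move=> exy; have eyx : e y x by rewrite e_sym.
have := depth_adj exy; have := depth_adj eyx; case: (ltngtP (d x) (d y)) => [lt|lt|eq] le1 le2.
- by apply: AdjUp; rewrite inE exy /= eqn_leq le2.
- by apply: AdjDown; rewrite inE eyx /= eqn_leq le1.
- exact: AdjSide.
Qed.

Lemma below_nonempty w : w != r -> exists v, v \in below w.
Proof.
move=> nwr; have [x [_ exw dw]] := dist_pred (conn r w) nwr.
by exists x; rewrite inE exw /d dw eqxx.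
Qed.

Lemma lone_neq_root w : lone w -> w != r.
Proof.
apply: contraTneq => ->; rewrite /lone (_ : below r = set0) ?cards0 //.
by apply/setP => v; rewrite !inE depth_root andbF.
Qed.

Lemma flat_lone w : flat w -> lone w. Proof. by case/andP. Qed.

Lemma flat_neq_root w : flat w -> w != r.
Proof. by move=> /flat_lone/lone_neq_root. Qed.

Lemma bfs_rank_inj : injective rho.
Proof.
move=> u v eqr; apply/enum_rank_inj/val_inj => /=.
have lt_u := ltn_ord (enum_rank u); have lt_v := ltn_ord (enum_rank v).
 move/(congr1 (modn^~ #|T|)): eqr.
by rewrite /= !modnMDl !modn_small.
Qed.

Lemma bfs_rank_depth u v : d u < d v -> rho u < rho v.
Proof. by apply: lex_lt; rewrite ltn_ord. Qed.

Lemma bfs_rank_above v w : w \in above v -> rho v < rho w.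
Proof. by move=> /above_depth dw; apply: bfs_rank_depth; rewrite dw. Qed.

Lemma first_ofP (S : {set T}) v : v \in S ->
  first_of S \in S /\ forall u, u \in S -> rho (first_of S) <= rho u.
Proof.
move=> vS; rewrite /first_of; case: pickP => [x /andP[xS /forall_inP]|] //=.
case: (arg_minnP rho vS) => x xS minx /(_ x) /andP[]; split=> //.
exact/forall_inP.
Qed.

Lemma last_ofP (S : {set T}) v : v \in S ->
  last_of S \in S /\ forall u, u \in S -> rho u <= rho (last_of S).
Proof.
move=> vS; rewrite /last_of; case: pickP => [x /andP[xS /forall_inP]|] //=.
case: (arg_maxnP rho vS) => x xS maxx /(_ x) /andP[]; split=> //.
exact/forall_inP.
Qed.

Lemma first_last v w : rho v < rho w ->
  first_of [set v; w] = v /\ last_of [set v; w] = w.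
Proof.
move=> ltvw; have v_in : v \in [set v; w] by rewrite !inE eqxx.
have w_in : w \in [set v; w] by rewrite !inE eqxx orbT.
have [f_in /(_ _ v_in) le_f] := first_ofP v_in.
have [l_in /(_ _ w_in) le_l] := last_ofP v_in.
split.
  by move: f_in; rewrite !inE => /orP[/eqP //|/eqP fw]; rewrite fw leqNgt ltvw in le_f.
by move: l_in; rewrite !inE => /orP[/eqP lv|/eqP //]; rewrite lv leqNgt ltvw in le_l.
Qed.

Lemma above_pair_inj v w v' w' : w \in above v -> w' \in above v' ->
  [set v; w] = [set v'; w'] -> v = v' /\ w = w'.
Proof.
move=> /bfs_rank_above/first_last[Ev Ew] /bfs_rank_above/first_last[Ev' Ew'] E.
by split; [rewrite -Ev E | rewrite -Ew E].
Qed.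

Lemma par1P w : w != r ->
  par1 w \in below w /\ forall v, v \in below w -> rho (par1 w) <= rho v.
Proof. by move=> /below_nonempty[v]; exact: first_ofP. Qed.

Lemma above_par1 w : w != r -> w \in above (par1 w).
Proof. by move=> /par1P[]; rewrite mem_above. Qed.

Lemma par1_twin w w' : below w' = below w -> par1 w' = par1 w.
Proof. by rewrite /par1 => ->. Qed.

Lemma par2_twin w w' : below w' = below w -> par2 w' = par2 w.
Proof. by rewrite /par2 /par1 => ->. Qed.

Lemma lone_twin w w' : below w' = below w -> lone w' = lone w.
Proof. by rewrite /lone => ->. Qed.

Lemma above_twin v w w' : below w' = below w -> w \in above v -> w' \in above v.
Proof. by rewrite !mem_above => ->. Qed.

Lemma par2P w : w != r -> ~~ lone w ->
  [/\ par2 w \in below w, par2 w != par1 w &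
      forall v, v \in below w -> v != par1 w -> rho (par2 w) <= rho v].
Proof.
move=> nwr nlone; have [p_in _] := par1P nwr.
have [v v_in] : exists v, v \in below w :\ par1 w.
  apply/set0Pn; rewrite -card_gt0; move: nlone; rewrite /lone (cardsD1 (par1 w)) p_in.
  by case: #|_|.
have [] := first_ofP v_in; rewrite -/(par2 w) in_setD1 => /andP[-> ->] minp.
by split=> // u u_in nu; apply: minp; rewrite in_setD1 nu.
Qed.

Lemma lone_below v w : lone w -> v \in below w -> v = par1 w.
Proof.
move=> lw vw; have [+ _] := par1P (lone_neq_root lw); move: lw vw.
by rewrite /lone => /cards1P[x ->]; rewrite !inE => /eqP -> /eqP ->.
Qed.

Lemma flat_adj_sym : symmetric flat_adj.
Proof. by move=> x y; rewrite /flat_adj /= e_sym andbCA. Qed.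

Lemma flat_csym : connect_sym flat_adj.
Proof. exact: sym_connect_sym flat_adj_sym. Qed.

Lemma flat_above x : flat x -> above x = set0.
Proof. by case/andP => _ /eqP. Qed.

(** An edge changing level would give its lower end an upper neighbor, which a flat vertex lacks. *)
Lemma flat_adj_depth x y : flat_adj x y -> d x = d y.
Proof.
case/and3P => /flat_above ax /flat_above ay /adjP[] //; by rewrite ?ax ?ay inE.
Qed.

Lemma connect_flat_depth x y : connect flat_adj x y -> d x = d y.
Proof.
case/connectP => p; elim: p x => [|z p IHp] x /=; first by move=> _ ->.
by case/andP => /flat_adj_depth -> /IHp.
Qed.

Lemma connect_flat x y : flat x -> connect flat_adj x y -> flat y.
Proof.
move=> + /connectP[p]; elim: p x => [|z p IHp] x /=; first by move=> ? _ ->.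
by move=> _ /andP[/and3P[_ fz _] /IHp]; apply.
Qed.

Lemma flat_rootP x : connect flat_adj x (flat_root x).
Proof. exact: fingraph.connect_root. Qed.

Lemma flat_root_eq x y : (flat_root x == flat_root y) = connect flat_adj x y.
Proof. exact: (fingraph.root_connect flat_csym). Qed.

Lemma flat_rootK x : flat_root (flat_root x) = flat_root x.
Proof. by apply/eqP; rewrite flat_root_eq flat_csym flat_rootP. Qed.

Lemma flat_flat_root x : flat x -> flat (flat_root x).
Proof. by move=> fx; exact: connect_flat fx (flat_rootP x). Qed.

(** One neighbor below and none above leave, by minimum degree two, a neighbor in the same level. *)
Lemma side_nbrP u : flat u -> e u (side_nbr u) /\ d (side_nbr u) = d u.
Proof.
move=> fu; rewrite /side_nbr; case: pickP => [z /andP[euz /eqP]|no_z] //=.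
have := deg2 u; rewrite degreeE // leqNgt; case/negP; rewrite ltnS.
rewrite -(cards1 (par1 u)) subset_leq_card //; apply/subsetP => z; rewrite !inE => euz.
case: (adjP euz) => [|uz|dz]; first by rewrite flat_above ?inE.
  by rewrite (lone_below (flat_lone fu) (v := z)) // -mem_above.
by have := no_z z; rewrite euz dz eqxx.
Qed.

Lemma twin_rep_below w : below (twin_rep w) = below w.
Proof. by rewrite /twin_rep; case: pickP => [x /eqP|]. Qed.

Lemma twin_rep_twin w w' : below w' = below w -> twin_rep w' = twin_rep w.
Proof.
move=> tw; rewrite /twin_rep (eq_pick (Q := fun x => below x == below w)).
  by case: pickP => // /(_ w); rewrite eqxx.
by move=> x; rewrite tw.
Qed.

Lemma star_above v : above v != set0 -> star v \in above v.
Proof.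
case/set0Pn => w; rewrite /star; case: pickP => [w0 w0v _|/(_ w) ->] //=.
case: ifP => _; first by case: pickP => [x /andP[/eqP tw _]|_] //=; exact: above_twin tw w0v.
by case: ifP => // _; exact: above_twin (twin_rep_below w0) w0v.
Qed.

(** Where [v] is the first parent, [star] prefers an unmarked twin; if it is marked nevertheless,
    all twins are. So postponing the star edge never puts a marked vertex behind an unmarked
    twin. *)
Lemma star_marked v w : v = par1 (star v) -> marked (star v) ->
  below w = below (star v) -> marked w.
Proof.
rewrite /star; set w0 := odflt v _; case: ifP => [_|nv].
  case: pickP => [x /andP[_ /negPf ->]|no_x] //= _ _ tw.
  by have := no_x w; rewrite tw eqxx => /negbFE.
case: ifP => _ vp; last by rewrite {1}vp eqxx in nv.
by rewrite (par1_twin (twin_rep_below w0)) in vp; rewrite {1}vp eqxx in nv.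
Qed.

(** With several lower neighbors the twin representative is marked: its first downward edge already
    tells it from its twins. *)
Lemma star_par2 v : v != par1 (star v) -> v = par2 (star v) ->
  star v = twin_rep (star v).
Proof.
rewrite /star; set w0 := odflt v _; case: ifP => [/eqP vw0|_].
  case: pickP => [x /andP[/eqP tw _]|_] /=; last by rewrite -vw0 eqxx.
  by rewrite (par1_twin tw) -vw0 eqxx.
case: ifP => [_ _ _|nv _ vp]; last by rewrite {1}vp eqxx in nv.
by rewrite (twin_rep_twin (twin_rep_below w0)).
Qed.

Lemma separated_sym w w' : separated w w' = separated w' w.
Proof.
rewrite /separated eq_sym; case: eqVneq => //= _.
case: (below w' =P below w) => [tw|ntw]; last by case: eqP => // /esym.
by rewrite tw eqxx (lone_twin tw) orbC flat_csym (andbCA (flat w)).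
Qed.

Lemma marked_separated w w' : separated w w' -> marked w' ->
  w' \in [:: if lone w then flat_root w else twin_rep w; side_nbr (flat_root w)].
Proof.
case/and4P => _ /eqP tw + _; rewrite /marked (lone_twin tw) !inE.
case: (lone w) => /= [/and3P[_ _]|_ /eqP w'E].
  by rewrite -flat_root_eq => /eqP -> /andP[].
by rewrite {1}w'E (twin_rep_twin tw) eqxx.
Qed.

(** * Comparing edges in the coloring order *)

Lemma edge_rank_inj : injective edge_rank.
Proof.
move=> f g; rewrite /edge_rank => eqr; apply/enum_rank_inj/val_inj => /=.
have lt_f := ltn_ord (enum_rank f); have lt_g := ltn_ord (enum_rank g).
move/(congr1 (modn^~ #|{set T}|)): eqr; rewrite /= !modnMDl !modn_small //.
Qed.

Lemma earlier_neq g f : earlier g f -> g != f.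
Proof. by rewrite /earlier; apply: contraTneq => ->; rewrite ltnn. Qed.

Lemma earlier_asym g f : earlier g f -> ~~ earlier f g.
Proof. by rewrite /earlier => /ltnW; rewrite leqNgt. Qed.

Lemma earlier_total g f : g != f -> earlier g f || earlier f g.
Proof. by rewrite /earlier -neq_ltn (inj_eq edge_rank_inj). Qed.

Lemma earlier_tier g f : tier g < tier f -> earlier g f.
Proof.
move=> lt_t; apply: lex_lt; first exact: ltn_ord.
apply: lex_lt; first exact: leq_b1.
apply: lex_lt; first exact: leq_b1.
by apply: lex_lt => //; rewrite ltnS leq_bigmax.
Qed.

Lemma tier_above v w : w \in above v -> tier [set v; w] = 0.
Proof.
by move=> vw; have [fE lE] := first_last (bfs_rank_above vw); rewrite /tier fE lE vw.
Qed.

Lemma tier_side x y : e x y -> d x = d y ->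
  tier [set x; y] = if is_closing [set x; y] then 2 else 1.
Proof.
move=> exy dxy; have x_in : x \in [set x; y] by rewrite !inE eqxx.
have [f_in _] := first_ofP x_in; have [l_in _] := last_ofP x_in.
have dE z : z \in [set x; y] -> d z = d x by rewrite !inE => /orP[]/eqP->.
rewrite /tier ifF //; apply/negP => /above_depth.
by rewrite (dE _ l_in) (dE _ f_in) => /eqP; rewrite eqn_leq ltnn andbF.
Qed.

Lemma earlier_above v w v' w' : w \in above v -> w' \in above v' ->
  rho v < rho v' -> earlier [set v; w] [set v'; w'].
Proof.
move=> vw vw' lt_v; rewrite /earlier /edge_rank !tier_above //.
have [-> ->] := first_last (bfs_rank_above vw).
have [-> ->] := first_last (bfs_rank_above vw').
apply: lex_lt; first exact: ltn_ord.
apply: lex_lt; first exact: leq_b1.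
by apply: lex_lt; first exact: leq_b1.
Qed.

Lemma earlier_star v w : w \in above v -> w != star v ->
  earlier [set v; w] [set v; star v].
Proof.
move=> vw nw; have vs : star v \in above v by apply: star_above; apply/set0Pn; exists w.
rewrite /earlier /edge_rank !tier_above //.
have [-> ->] := first_last (bfs_rank_above vw).
have [-> ->] := first_last (bfs_rank_above vs).
apply: lex_lt; first exact: ltn_ord.
apply: lex_lt; first exact: leq_b1.
by rewrite eqxx eq_sym (negPf nw); lia.
Qed.

Lemma earlier_marked v w w' : w \in above v -> w' \in above v -> w != star v ->
  marked w -> ~~ marked w' -> earlier [set v; w] [set v; w'].
Proof.
move=> vw vw' nw mw nmw'.
have [->|nw'] := eqVneq w' (star v); first exact: earlier_star.
rewrite /earlier /edge_rank !tier_above //.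
have [-> ->] := first_last (bfs_rank_above vw).
have [-> ->] := first_last (bfs_rank_above vw').
rewrite ![star v == _]eq_sym (negPf nw) (negPf nw') mw nmw'.
by apply: lex_lt; [exact: ltn_ord | rewrite ltn_add2l].
Qed.

Lemma earlier_side v w x y : w \in above v -> e x y -> d x = d y ->
  earlier [set v; w] [set x; y].
Proof.
move=> vw exy dxy; apply: earlier_tier; rewrite tier_above // tier_side //.
by case: is_closing.
Qed.

Lemma earlier_closing u g : flat u -> flat_root u = u -> g \in edges e ->
  ~~ is_closing g -> earlier g (closing u).
Proof.
move=> fu ru; have [eus dus] := side_nbrP fu.
have cu : is_closing (closing u) by apply/existsP; exists u; rewrite fu ru !eqxx.
case/(edgesP) => x [y [exy ->]] ncl; case: (adjP exy) => [xy|yx|dxy].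
- exact: earlier_side.
- rewrite set2C; exact: earlier_side.
apply: earlier_tier; rewrite (tier_side exy dxy) (tier_side eus) // -/(closing u) cu.
by rewrite (negPf ncl).
Qed.

(** The side neighbor of a root need not be flat; when it is, it is adjacent to the root in
    [flat_adj] and lies in its component. *)
Lemma closing_root u y : flat u -> flat_root u = u -> y \in closing u -> flat y ->
  flat_root y = u.
Proof.
move=> fu ru; rewrite !inE => /orP[]/eqP -> // fs; rewrite -{2}ru; apply/eqP.
rewrite flat_root_eq flat_csym connect1 // /flat_adj /= fu fs.
by case: (side_nbrP fu).
Qed.

(** Downward edges of [w] go by increasing lower end, upward ones have the higher lower end [w], and
    those inside the level have a higher tier. *)
Lemma par1_lowest w g : w != r -> g \in incident e w ->
  ~~ earlier g [set par1 w; w].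
Proof.
move=> nwr /incidentP[//|x ewx ->]; have pw := above_par1 nwr.
case: (adjP ewx) => [wx|xw|dx].
- by apply/earlier_asym/earlier_above => //; exact: bfs_rank_above.
- have [_ /(_ x)] := par1P nwr; rewrite -mem_above => /(_ xw).
  rewrite leq_eqVlt => /orP[/eqP/bfs_rank_inj ->|lt]; rewrite set2C; last first.
    by apply/earlier_asym/earlier_above.
  by rewrite /earlier ltnn.
- by apply/earlier_asym/earlier_side.
Qed.

Lemma par2_lowest w g : w != r -> ~~ lone w -> g \in incident e w ->
  earlier g [set par2 w; w] -> g = [set par1 w; w].
Proof.
move=> nwr nlone /incidentP[//|x ewx ->]; have [p2w _ minp2] := par2P nwr nlone.
have pw : w \in above (par2 w) by rewrite mem_above.
case: (adjP ewx) => [wx|xw|dx]; last first.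
- by move=> /earlier_asym; rewrite earlier_side.
- rewrite set2C; have [->//|nx] := eqVneq x (par1 w).
  have := minp2 x; rewrite -mem_above => /(_ xw nx).
  rewrite leq_eqVlt => /orP[/eqP/bfs_rank_inj ->|lt].
    by rewrite /earlier ltnn.
  by move=> /earlier_asym; rewrite earlier_above.
- by move=> /earlier_asym; rewrite earlier_above // bfs_rank_above.
Qed.

End Layers.

(** * The coloring rules when some vertex has degree at least four *)

Section Coloring.

Variables (T : finType) (e : rel T) (r y1 y2 : T) (s : nat).
Hypotheses (e_sym : symmetric e) (e_irr : irreflexive e).
Hypothesis conn : forall x y, connect e x y.
Hypothesis deg2 : forall u, 2 <= degree e u.
Hypothesis deg_le : forall u, degree e u <= s * s.
Hypothesis deg_r : 4 <= degree e r.
Hypothesis s_gt1 : 1 < s.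
Hypotheses (ry1 : e r y1) (ry2 : e r y2) (ny12 : y1 != y2).
Hypothesis nsep12 : ~~ separated e r y1 y2.

Local Notation d := (depth e r).
Local Notation rho := (bfs_rank e r).
Local Notation below := (below e r).
Local Notation above := (above e r).
Local Notation lone := (lone e r).
Local Notation flat := (flat e r).
Local Notation flat_adj := (flat_adj e r).
Local Notation flat_root := (flat_root e r).
Local Notation side_nbr := (side_nbr e r).
Local Notation marked := (marked e r).
Local Notation separated := (separated e r).
Local Notation par1 := (par1 e r).
Local Notation par2 := (par2 e r).
Local Notation star := (star e r).
Local Notation closing := (closing e r).
Local Notation is_closing := (is_closing e r).
Local Notation edge_rank := (edge_rank e r).
Local Notation earlier := (earlier e r).
Local Notation coloring := ({set T} -> nat).

(* Color 0 is reserved for these two edges, so that [r] is fixed. *)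
Definition zero_edge (f : {set T}) : bool := (f == [set r; y1]) || (f == [set r; y2]).

(** The twins that the first downward edge fails to tell from [w]; the twin, palette, side and
    component rules deal with these. *)
Definition mate (c : coloring) (w w' : T) : bool :=
  [&& w' != w, below w' == below w & c [set par1 w; w'] == c [set par1 w; w]].
(** Both first downward edges have to precede [f], so that a rule at [f] depends on earlier colors
    only. *)
Definition mate_before (f : {set T}) (c : coloring) w w' :=
  [&& mate c w w', earlier [set par1 w; w'] f & earlier [set par1 w; w] f].

Definition lower (u : T) (f : {set T}) : {set {set T}} :=
  [set g in incident e u | earlier g f].
Definition lower_twins (v w : T) : {set T} :=
  [set w' | (below w' == below w) && earlier [set v; w'] [set v; w]].
Definition flat_depth (x : T) : nat := dist flat_adj (flat_root x) x.
(** Edges with only one end in the component count as well; thus the closing edge belongs to it even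
    when the side neighbor of the root is not flat. *)
Definition component_edges (x : T) : {set {set T}} :=
  [set g in edges e | [exists y in g, connect flat_adj x y]].

(** Counting earlier edges is enough: the test at the last edge of color [a] at [u] bounds the whole
    color class. *)
Definition maj_rule (f : {set T}) (c : coloring) (a : nat) : Prop :=
  exists2 u, u \in f & (degree e u)./2 <= #|[set g in lower u f | c g == a]|.
Definition sep_rule (v w : T) (c : coloring) (a : nat) : Prop :=
  v = par1 w /\ exists w',
    [/\ separated w w', earlier [set v; w'] [set v; w] & a = c [set v; w']].
(* Groups have at most [s] members; one place is left for [star v]. *)
Definition cap_rule (v w : T) (c : coloring) (a : nat) : Prop :=
  [/\ v = par1 w, w != star v &
      s.-1 <= #|[set w' in lower_twins v w | c [set v; w'] == a]|].
Definition twin_rule (v w : T) (c : coloring) (a : nat) : Prop :=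
  [/\ ~~ lone w, v = par2 w & exists w',
    [/\ mate_before [set v; w] c w w', earlier [set v; w'] [set v; w]
       & a = c [set v; w']]].
(** Palettes are compared as multisets, color by color; [a] completes that of [v], while that of
    [v'] is already complete. *)
Definition palette_rule (v w : T) (c : coloring) (a : nat) : Prop :=
  [/\ lone v, w = star v & exists v',
    [/\ mate_before [set v; w] c v v',
        forall x, x \in above v' -> earlier [set v'; x] [set v; w] &
        forall b, #|[set x in above v | earlier [set v; x] [set v; w] && (c [set v; x] == b)]|
           + (a == b) = #|[set x in above v' | c [set v'; x] == b]|]].
(** Here [y] is a common neighbor of [x] and [x'] nearer to the root of the component; once [y] is
    fixed, its edges to the two must differ. *)
Definition side_rule (f : {set T}) (c : coloring) (a : nat) : Prop :=
  exists x y x', [/\ f = [set y; x], flat_adj y x, flat_depth y < flat_depth x &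
    [/\ mate_before f c x x', flat_adj y x', flat_depth x' = flat_depth x,
        earlier [set y; x'] f & a = c [set y; x']]].
Definition component_rule (f : {set T}) (c : coloring) (a : nat) : Prop :=
  exists x x', [/\ flat x, flat_root x = x, f = closing x &
    [/\ mate_before f c x x', forall g, g \in component_edges x' -> earlier g f &
        forall b, #|[set g in component_edges x | earlier g f && (c g == b)]| + (a == b)
          = #|[set g in component_edges x' | c g == b]|]].
Definition above_rule (f : {set T}) (c : coloring) (a : nat) : Prop :=
  exists v w, [/\ f = [set v; w], w \in above v &
    [\/ sep_rule v w c a, cap_rule v w c a, twin_rule v w c a | palette_rule v w c a]].
Definition rule (f : {set T}) (c : coloring) (a : nat) : Prop :=
  f \in edges e /\
  ((zero_edge f /\ a <> 0) \/
   (~~ zero_edge f /\ [\/ a = 0, maj_rule f c a, above_rule f c a |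
                          side_rule f c a \/ component_rule f c a])).

Lemma mate_before_local f c c' w w' :
  (forall g, earlier g f -> c g = c' g) -> mate_before f c w w' -> mate_before f c' w w'.
Proof. by move=> E /and3P[+ e1 e2]; rewrite /mate_before /mate e1 e2 !E // !andbT. Qed.

Lemma rule_local f c c' a : (forall g, earlier g f -> c g = c' g) ->
  rule f c a -> rule f c' a.
Proof.
move=> E [fe H]; split=> //; case: H => [[? ?]|[nz H]]; [by left|right; split=> //].
case: H => [->|[u uf H]|[v [w [fE wv H]]]|H].
- exact: Or41.
- apply: Or42; exists u => //; rewrite (eq_card_in (Q := fun g => c g == a)) // => g.
  by rewrite inE => /andP[_ /E ->].
- apply: Or43; exists v, w; split=> //; rewrite fE in E.
  case: H => [[vp [w' [sep eaw ->]]]|[vp ns le]|[nl vp [w' [mt eaw ->]]]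
             |[lv ws [v' [mt ea le]]]].
  + by apply: Or41; split=> //; exists w'; rewrite E.
  + apply: Or42; split=> //; rewrite (eq_card_in (Q := fun w' => c [set v; w'] == a)) // => w'.
    by rewrite inE => /andP[_ /E ->].
  + by apply: Or43; split=> //; exists w'; rewrite -E //; split=> //; exact: mate_before_local mt.
  + apply: Or44; split=> //; exists v'; split=> //; first exact: mate_before_local mt.
    move=> b; have <- : #|[set x in above v' | c [set v'; x] == b]|
                      = #|[set x in above v' | c' [set v'; x] == b]|.
      by apply: eq_card_in => x xv'; rewrite E ?ea.
    rewrite -le; congr (_ + _); apply: eq_card_in => x _.
    by case: (boolP (earlier _ _)) => // /E ->.
- apply: Or44.
  case: H => [[x [y [x' [fE yx ltD [mt yx' eqD eaw ->]]]]]|[x [x' [fx rx fE [mt ea le]]]]].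
    left; exists x, y, x'; rewrite -E //; split=> //; split=> //; exact: mate_before_local mt.
  right; exists x, x'; split=> //; split=> //; first exact: mate_before_local mt.
  move=> b; have <- : #|[set g in component_edges x' | c g == b]|
                    = #|[set g in component_edges x' | c' g == b]|.
    by apply: eq_card_in => g gx'; rewrite E ?ea.
  rewrite -le; congr (_ + _); apply: eq_card_in => g _.
  by case: (boolP (earlier _ _)) => // /E ->.
Qed.

(** The threshold [m] lets the same lemmas serve during the construction, with the rank of the next
    edge, and for the finished coloring. *)
Definition obeys (m : nat) (c : coloring) : Prop :=
  forall g, edge_rank g < m -> ~ rule g c (c g).

Lemma above_root y : e r y -> y \in above r.
Proof.
move=> ery; case: (adjP r e_sym conn ery) => // [/above_neq_root|].
  by rewrite eqxx.
by rewrite depth_root => /esym/(depth_eq0 conn) yr; rewrite yr e_irr in ery.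
Qed.

Lemma zero_edge_above v w : w \in above v -> zero_edge [set v; w] ->
  v = r /\ (w = y1 \/ w = y2).
Proof.
by move=> wv /orP[]/eqP /(above_pair_inj wv)-/(_ (above_root _))[//|-> ->]; auto.
Qed.

Lemma zero_edge_side x y : e x y -> d x = d y -> ~~ zero_edge [set x; y].
Proof.
move=> exy dxy; apply/negP => z.
have dE u : u \in [set x; y] -> d u = d x by rewrite !inE => /orP[]/eqP->.
have := dE r; case/orP: z => /eqP E; rewrite E.
  have := dE y1; rewrite E !inE !eqxx orbT /= => /(_ isT) <- /(_ isT) /eqP.
  by rewrite (above_depth (above_root ry1)) eqn_leq ltnn andbF.
have := dE y2; rewrite E !inE !eqxx orbT /= => /(_ isT) <- /(_ isT) /eqP.
by rewrite (above_depth (above_root ry2)) eqn_leq ltnn andbF.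
Qed.

Lemma above_edges v w : w \in above v -> [set v; w] \in edges e.
Proof. by move=> /above_adj/mem_edges. Qed.

Lemma obeys_zero m c f : obeys m c -> f \in edges e -> edge_rank f < m ->
  (c f == 0) = zero_edge f.
Proof.
move=> ok fe /ok nr; case: (boolP (zero_edge f)) => z.
  by apply/negP => /negP c0; apply: nr; split=> //; left; split=> //; exact/eqP.
by apply/negP => /eqP c0; apply: nr; split=> //; right; split=> //; apply: Or41.
Qed.

Lemma obeys_above m c v w : obeys m c -> w \in above v -> edge_rank [set v; w] < m ->
  ~~ zero_edge [set v; w] ->
  ~ [\/ sep_rule v w c (c [set v; w]), cap_rule v w c (c [set v; w]),
        twin_rule v w c (c [set v; w]) | palette_rule v w c (c [set v; w])].
Proof.
move=> ok wv /ok nr nz H; apply: nr; split; first exact: above_edges.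
by right; split=> //; apply: Or43; exists v, w.
Qed.

(** The later edge met the separation rule unless it is a zero edge; equal colors then make both
    zero edges, but [y1] and [y2] are not separated. *)
Lemma obeys_separated m c w w' : obeys m c -> w != r -> separated w w' ->
  edge_rank [set par1 w; w] < m -> edge_rank [set par1 w; w'] < m ->
  c [set par1 w; w] != c [set par1 w; w'].
Proof.
move=> ok.
suff main u u' : u != r -> separated u u' -> earlier [set par1 u; u'] [set par1 u; u] ->
    edge_rank [set par1 u; u] < m -> edge_rank [set par1 u; u'] < m ->
    c [set par1 u; u] != c [set par1 u; u'].
  move=> nwr sep lt lt'; have /and4P[nw /eqP tw _ _] := sep.
  have wa : w' \in above (par1 w) by apply: above_twin tw _; exact: (above_par1 conn).
  have nE : [set par1 w; w'] != [set par1 w; w].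
    by apply: contraNneq nw => /set2_inj ->.
  case/orP: (earlier_total e r nE) => ea; first exact: main.
  rewrite eq_sym; have := main w' w; rewrite (par1_twin tw); apply=> //.
    exact: above_neq_root wa.
  by rewrite (separated_sym r e_sym).
move=> nur sep ea lt lt'; have /and4P[nu /eqP tw _ _] := sep.
have ua := above_par1 conn nur; have ua' := above_twin tw ua.
apply/eqP => E; case: (boolP (zero_edge [set par1 u; u])) => z.
  have z' : zero_edge [set par1 u; u'].
    by rewrite -(obeys_zero ok) ?above_edges // -E (obeys_zero ok) ?above_edges.
  have [_ uy] := zero_edge_above ua z; have [_ uy'] := zero_edge_above ua' z'.
  move: nsep12 sep nu; case: uy => ->; case: uy' => ->; rewrite ?eqxx //.
  - by move=> /negPf ->.
  - by rewrite (separated_sym r e_sym) => /negPf ->.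
apply: (obeys_above ok ua lt z); apply: Or41; split=> //.
by exists u'.
Qed.

(** A group has at most [s] members. Color 0 occurs on two edges only. For another color and more
    than [s] members, the last one colored among those other than [star v] would have met [s - 1]
    earlier ones, against the cap rule. *)
Lemma obeys_mates m c w : obeys m c -> w != r ->
  (forall w', below w' = below w -> edge_rank [set par1 w; w'] < m) ->
  #|[set w' | mate c w w']| <= s.-1.
Proof.
move=> ok nwr lt_m; set v := par1 w; set b := c [set v; w].
pose M := [set w' | (below w' == below w) && (c [set v; w'] == b)].
have wM : w \in M by rewrite inE !eqxx.
have -> : [set w' | mate c w w'] = M :\ w.
  by apply/setP => x; rewrite !inE.
suff : #|M| <= s by rewrite (cardsD1 w M) wM add1n; case: (s) s_gt1.
have Ma x : x \in M -> x \in above v.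
  by rewrite inE => /andP[/eqP tw _]; apply: above_twin tw _; exact: (above_par1 conn).
have Mlt x : x \in M -> edge_rank [set v; x] < m.
  by rewrite inE => /andP[/eqP tw _]; exact: lt_m.
have Mb x : x \in M -> c [set v; x] = b by rewrite inE => /andP[_ /eqP].
have [b0|nb0] := eqVneq b 0.
  apply: leq_trans s_gt1; apply: (@leq_trans #|[set y1; y2]|); last first.
    by rewrite cards2; case: eqP.
  apply/subset_leq_card/subsetP => x xM.
  have : zero_edge [set v; x] by rewrite -(obeys_zero ok) ?above_edges ?Ma ?Mlt // Mb // b0.
  by case/(zero_edge_above (Ma _ xM)) => _ [] ->; rewrite !inE eqxx ?orbT.
rewrite leqNgt; apply/negP => lt_sM.
have lt_sM' : s <= #|M :\ star v|.
  by move: lt_sM; rewrite (cardsD1 (star v)); case: (_ \in _); rewrite ?add1n // add0n; exact: ltnW.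
have [x0 x0M] : exists x, x \in M :\ star v.
  by apply/set0Pn; rewrite -card_gt0; apply: leq_trans lt_sM'; exact: ltnW.
case: (arg_maxnP (fun x => edge_rank [set v; x]) x0M) => x.
rewrite -[_ x]/(x \in M :\ star v) => xM' maxx.
have /andP[nx xM] : (x != star v) && (x \in M) by rewrite -in_setD1.
have xtw : below x = below w by move: xM; rewrite inE => /andP[/eqP].
have nz : ~~ zero_edge [set v; x] by rewrite -(obeys_zero ok) ?above_edges ?Ma ?Mlt // Mb.
apply: (obeys_above ok (Ma _ xM) (Mlt _ xM) nz); apply: Or42; split=> //.
  by rewrite (par1_twin xtw).
have : s.-1 <= #|(M :\ star v) :\ x|.
  by move: lt_sM'; rewrite (cardsD1 x) xM' -subn1 leq_subLR.
move/leq_trans; apply; apply/subset_leq_card/subsetP => z.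
rewrite in_setD1 => /andP[nzx zM']; have /andP[_ zM] : (z != star v) && (z \in M) by rewrite -in_setD1.
have tw : below z = below w by move: zM; rewrite [_ \in M]inE => /andP[/eqP].
rewrite inE Mb // Mb // eqxx andbT inE tw xtw eqxx /=.
have /= le_zx := maxx _ zM'; rewrite /earlier ltn_neqAle le_zx andbT (inj_eq (@edge_rank_inj _ e r)).
by apply: contraNneq nzx => /set2_inj ->.
Qed.

(** * Counting the forbidden colors *)

Lemma lower_le u f : f \in incident e u -> #|lower u f| <= (degree e u).-1.
Proof.
move=> fu; rewrite /degree (cardsD1 f (incident e u)) fu add1n /=.
apply/subset_leq_card/subsetP => g; rewrite in_setD1 [g \in lower _ _]inE.
by case/andP => -> /earlier_neq ->.
Qed.

Lemma few_maj k u f c : #|lower u f| < (degree e u)./2 * k.+1 ->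
  few k (fun a => (degree e u)./2 <= #|[set g in lower u f | c g == a]|).
Proof. exact: few_frequent. Qed.

(** Three frequent colors would take [3 * floor(d/2)] earlier edges, more than [d - 1]. *)
Lemma few_maj2 u f c : f \in incident e u ->
  few 2 (fun a => (degree e u)./2 <= #|[set g in lower u f | c g == a]|).
Proof.
move=> /lower_le le_l; apply: few_maj.
by have := odd_double_half (degree e u); have := deg2 u; lia.
Qed.

(** With [h] still to come, at most [d - 2] edges are earlier, fewer than [2 * floor(d/2)]. *)
Lemma few_maj1 u f h c : f \in incident e u -> h \in incident e u -> earlier f h ->
  few 1 (fun a => (degree e u)./2 <= #|[set g in lower u f | c g == a]|).
Proof.
move=> fu hu fh; apply: few_maj.
have lt : (#|lower u f|).+2 <= degree e u.
  rewrite /degree (cardsD1 f (incident e u)) fu (cardsD1 h (_ :\ f)) in_setD1 hu.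
  rewrite eq_sym (earlier_neq fh) !add1n !ltnS.
  apply/subset_leq_card/subsetP => g gl.
  have /andP[gu gf] : (g \in incident e u) && earlier g f by rewrite inE in gl.
  rewrite !in_setD1 gu (earlier_neq gf) !andbT.
  by apply: contraTneq gf => ->; exact: earlier_asym.
by have := odd_double_half (degree e u); have := deg2 u; lia.
Qed.

(** The common scheme of the symmetry rules: each of the at most [s - 1] mates of [w] forbids at
    most one color. *)
Lemma few_mates f c w (F : nat -> Prop) (P : T -> nat -> Prop) :
  obeys (edge_rank f) c -> w != r ->
  (forall x, x \in above (par1 w) -> earlier [set par1 w; x] f) ->
  (forall x a b, P x a -> P x b -> a = b) ->
  (forall a, F a -> exists2 x, mate c w x & P x a) -> few s.-1 F.
Proof.
move=> ok nwr lt funP FP.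
apply: (few_sub (leqnn _)) (few_image (X := [set x | mate c w x]) (P := P) _ funP).
  by move=> a /FP[x mx Px]; exists x; rewrite ?inE.
apply: (obeys_mates ok nwr) => x tw.
by apply: lt; apply: above_twin tw _; exact: (above_par1 conn).
Qed.

Lemma few_twin v w c : w \in above v -> obeys (edge_rank [set v; w]) c ->
  few s.-1 (twin_rule v w c).
Proof.
move=> wv ok; have nwr := above_neq_root wv.
case: (boolP (lone w)) => [lw|nlone]; first by apply: few0 => a [/negP].
have [vE|nv] := eqVneq v (par2 w); last first.
  by apply: few0 => a [_ /eqP]; rewrite (negPf nv).
subst v; have [p2w np2 _] := par2P conn nwr nlone; have [p1w minp1] := par1P conn nwr.
have pw : w \in above (par2 w) by rewrite mem_above.
have lt12 : rho (par1 w) < rho (par2 w).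
  by rewrite ltn_neqAle minp1 // andbT (inj_eq (@bfs_rank_inj _ e r)) eq_sym.
apply: (few_mates (f := [set par2 w; w]) (w := w) (c := c)
         (P := fun x a => a = c [set par2 w; x])) => //.
- by move=> x xa; apply: earlier_above.
- by move=> x a b -> ->.
- by move=> a [_ _ [x [/and3P[mx _ _] _ ->]]]; exists x.
Qed.

Lemma few_palette v w c : w \in above v -> obeys (edge_rank [set v; w]) c ->
  few s.-1 (palette_rule v w c).
Proof.
move=> wv ok; case: (boolP (lone v)) => [lv|/negP nlv]; last by apply: few0 => a [].
have nvr := lone_neq_root lv; have pv := above_par1 conn nvr.
apply: (few_mates (f := [set v; w]) (w := v) (c := c) (P := fun v' a => forall b,
   #|[set x in above v | earlier [set v; x] [set v; w] && (c [set v; x] == b)]|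
           + (a == b) = #|[set x in above v' | c [set v'; x] == b]|)) => //.
- by move=> x xa; apply: earlier_above => //; exact: bfs_rank_above.
- by move=> x a b; exact: count_shift_inj.
- by move=> a [_ _ [x [/and3P[mx _ _] _ H]]]; exists x.
Qed.

(** At most two marked twins are separated from [w]. An unmarked earlier [w'] would force [w] to be
    marked; but marked vertices come first, and if [w] is the star then all its twins are marked. *)
Lemma few_separated v w c : w \in above v -> few 2 (sep_rule v w c).
Proof.
move=> wv; pose l := [:: if lone w then flat_root w else twin_rep e r w; side_nbr (flat_root w)].
apply: (@few_seq _ [seq c [set v; x] | x <- l]) => // a [vp [w' [sep ea ->]]].
apply/map_f/(marked_separated e_sym sep).
have /and4P[nw /eqP tw _ mm] := sep; case: (boolP (marked w')) mm => // nmw'; rewrite orbF => mw.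
have w'v := above_twin tw wv.
have [ws|nws] := eqVneq w (star v).
  have vp' : v = par1 (star v) by rewrite -ws.
  by rewrite (star_marked vp' (w := w')) -?ws in nmw'.
by have := earlier_asym ea; rewrite (earlier_marked wv w'v nws mw nmw').
Qed.

(** Neither [w] nor the star counts as earlier, so at most [s^2 - 2] twins do, while [s + 1] groups
    of [s - 1] would need [s^2 - 1]. This is where [Delta <= s^2] enters. *)
Lemma few_cap v w c : w \in above v -> few s (cap_rule v w c).
Proof.
move=> wv; have [ws|nws] := eqVneq w (star v).
  by apply: few0 => a [_ /eqP].
have sv : star v \in above v by apply: star_above; apply/set0Pn; exists w.
apply: (few_sub (leqnn s)
  (G := fun a => s.-1 <= #|[set w' in lower_twins v w | c [set v; w'] == a]|)).
  by move=> a [].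
apply: (few_frequent (fun w' => c [set v; w'])).
have lt : (#|lower_twins v w|).+2 <= s * s.
  apply: leq_trans (deg_le v); rewrite degreeE //.
  set A := [set x | e v x].
  have wA : w \in A by rewrite inE; exact: above_adj wv.
  have sA : star v \in A by rewrite inE; exact: above_adj sv.
  rewrite (cardsD1 w A) (cardsD1 (star v) (A :\ w)) in_setD1 wA sA eq_sym nws.
  rewrite !add1n !ltnS; apply/subset_leq_card/subsetP => x.
  rewrite [x \in lower_twins _ _]inE => /andP[/eqP tw ea].
  rewrite !in_setD1 inE (above_adj (above_twin tw wv)) andbT; apply/andP; split.
    by apply: contraTneq ea => ->; apply/earlier_asym/earlier_star.
  by apply: contraTneq ea => ->; rewrite /earlier ltnn.
by move: lt s_gt1; case: (s) => // s'; lia.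
Qed.

Lemma above_rule_inv v w c a : w \in above v -> above_rule [set v; w] c a ->
  [\/ sep_rule v w c a, cap_rule v w c a, twin_rule v w c a | palette_rule v w c a].
Proof. by move=> wv [v' [w' [E wv' H]]]; have [-> ->] := above_pair_inj wv wv' E. Qed.

(* The star edge of [v] has to respect the palette rule ([s.-1] colors); every
   other upward edge of [v] meets at most one color forbidden by the majority at
   [v], since the star edge is still uncolored. At [w] the majority forbids
   nothing on the first downward edge and at most one color on the second. *)
Lemma few_above v w c : w \in above v -> obeys (edge_rank [set v; w]) c ->
  few (s + 3) (fun a => maj_rule [set v; w] c a \/ above_rule [set v; w] c a).
Proof.
move=> wv ok; set f := [set v; w]; have nwr := above_neq_root wv.
have vf : f \in incident e v by apply: mem_incident => //; exact: above_adj wv.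
have wf : f \in incident e w.
  by rewrite /f set2C mem_incident // e_sym; exact: above_adj wv.
pose M u a := (degree e u)./2 <= #|[set g in lower u f | c g == a]|.
have majE a : maj_rule f c a -> M v a \/ M w a.
  by case=> u; rewrite !inE => /orP[]/eqP-> ?; [left|right].
have twin := few_twin wv ok; have pal := few_palette wv ok.
have mv2 : few 2 (M v) by exact: few_maj2.
have mv1 : w != star v -> few 1 (M v).
  move=> nws; apply: (few_maj1 (h := [set v; star v])) => //; last exact: earlier_star.
  by apply: mem_incident => //; apply: above_adj; apply: star_above; apply/set0Pn; exists w.
have npal : w != star v -> forall a, ~ palette_rule v w c a by move=> /eqP nws a [].
have s_pos : s = s.-1.+1 by case: (s) s_gt1.
have [vp|nvp] := eqVneq v (par1 w).
  have mw0 a : ~ M w a.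
    have l0 : lower w f = set0.
      by apply/setP => g; rewrite !inE -andbA; apply/and3P => -[ge gw]; apply/negP;
         rewrite /f vp; apply: par1_lowest => //; rewrite inE ge.
    rewrite /M l0 (_ : [set g in set0 | _] = set0); last by apply/setP => g; rewrite !inE.
    by rewrite cards0 leqNgt half_gt0 deg2.
  have ntwin a : ~ twin_rule v w c a.
    by case=> nl vp2 _; have [_ /eqP] := par2P conn nwr nl; rewrite -vp2 -vp.
  have [ws|nws] := eqVneq w (star v).
    (* Majority at [v], separation and palette: [2 + 2 + (s - 1)]. *)
    apply: (few_sub _ _ (few_or mv2 (few_or (few_separated c wv) pal))); first by (clear -s_pos; lia).
    move=> a [/majE[|/mw0]//|/(above_rule_inv wv)[]]; auto; last by move/ntwin.
    by case=> _; rewrite ws eqxx.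
  (* Majority at [v], separation and cap: [1 + 2 + s]. *)
  apply: (few_sub _ _ (few_or (mv1 nws) (few_or (few_separated c wv) (few_cap c wv)))).
    by (clear -s_pos; lia).
  move=> a [/majE[|/mw0]//|/(above_rule_inv wv)[]]; auto; first by move/ntwin.
  by move/(npal nws).
have nlone : ~~ lone w.
  apply: contra nvp => lw; apply/eqP; apply: (lone_below conn lw); by rewrite -mem_above.
have nsep a : ~ sep_rule v w c a by case=> /eqP; rewrite (negPf nvp).
have ncap a : ~ cap_rule v w c a by case=> /eqP; rewrite (negPf nvp).
have [vp2|nvp2] := eqVneq v (par2 w).
  have mw1 : few 1 (M w).
    apply: few_maj; apply: (@leq_ltn_trans 1).
      rewrite -(cards1 [set par1 w; w]) subset_leq_card //; apply/subsetP => g.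
      rewrite inE => /andP[gw]; rewrite /f vp2 => /(par2_lowest e_sym conn nwr nlone gw) ->.
      by rewrite inE.
    by have := deg2 w; rewrite -half_gt0; case: (_./2) => // n _; rewrite mulSn.
  have [ws|nws] := eqVneq w (star v).
    (* At its second parent the star is the twin representative; being marked, it is separated from
       all its twins and has no mate. *)
    have ntwin a : ~ twin_rule v w c a.
      case=> _ _ [x [/and3P[/and3P[nx tw /eqP cx] e1 e2] _ _]].
      have mw : marked w.
        rewrite /marked (negPf nlone) {1}ws; apply/eqP.
        by rewrite star_par2 -?ws.
      have sep : separated w x by rewrite /separated nx tw (negPf nlone) mw.
      by have := obeys_separated ok nwr sep e2 e1; rewrite cx eqxx.
    apply: (few_sub _ _ (few_or mv2 (few_or mw1 pal))); first by (clear -s_pos; lia).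
    move=> a [/majE[]|/(above_rule_inv wv)[]]; auto; first by move/nsep.
      by move/ncap.
    by move/ntwin.
  apply: (few_sub _ _ (few_or (mv1 nws) (few_or mw1 twin))); first by (clear -s_pos; lia).
  move=> a [/majE[]|/(above_rule_inv wv)[]]; auto; first by move/nsep.
    by move/ncap.
  by move/(npal nws).
(* At a third or later parent: majority at both ends and palette, [2 + 2 + (s - 1)]. *)
apply: (few_sub _ _ (few_or mv2 (few_or (few_maj2 c wf) pal))); first by (clear -s_pos; lia).
move=> a [/majE[]|/(above_rule_inv wv)[]]; auto; first by move/nsep.
  by move/ncap.
by case=> _ /eqP; rewrite (negPf nvp2).
Qed.

Lemma above_not_side v w x y : w \in above v -> e x y -> d x = d y ->
  [set v; w] <> [set x; y].
Proof.
by move=> wv exy dxy E; have := tier_above wv; rewrite E tier_side //; case: ifP.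
Qed.

Lemma above_no_side v w c a : w \in above v ->
  ~ (side_rule [set v; w] c a \/ component_rule [set v; w] c a).
Proof.
move=> wv [[x [y [x' [E yx _ _]]]]|[u [x' [fu ru E _]]]].
  have /and3P[_ _ eyx] := yx.
  exact: above_not_side wv eyx (flat_adj_depth e_sym conn yx) E.
have [eus dus] := side_nbrP e_sym conn deg2 fu.
exact: above_not_side wv eus (esym dus) E.
Qed.

(** The flat depths orient [f], so only the mates of its farther end compete. *)
Lemma few_side f c : obeys (edge_rank f) c -> few s.-1 (side_rule f c).
Proof.
move=> ok; case: (classic (exists y x,
    [/\ f = [set y; x], flat_adj y x & flat_depth y < flat_depth x])); last first.
  by move=> no; apply: few0 => a [x [y [x' [fE yx lt _]]]]; apply: no; exists y, x.
case=> y [x [fE yx ltD]]; have /and3P[fy fx eyx] := yx.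
have dyx := flat_adj_depth e_sym conn yx.
apply: (few_mates (f := f) (w := x) (c := c) (P := fun x' a => a = c [set y; x'])) => //.
- exact: flat_neq_root fx.
- by move=> z za; rewrite fE; apply: earlier_side.
- by move=> z a b -> ->.
move=> a [x0 [y0 [x' [fE0 yx0 ltD0 [/and3P[mx _ _] yx' eqD ea ->]]]]].
suff [Ey Ex] : y0 = y /\ x0 = x by exists x'; [rewrite -Ex | rewrite Ey].
have y_in : y \in [set y0; x0] by rewrite -fE0 fE !inE eqxx.
have x_in : x \in [set y0; x0] by rewrite -fE0 fE !inE eqxx orbT.
have nyx : y != x by apply: contraTneq eyx => ->; rewrite e_irr.
move: y_in x_in nyx ltD ltD0; rewrite !inE => /orP[]/eqP -> /orP[]/eqP -> //; rewrite ?eqxx //.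
by move=> _ /ltn_trans H /H; rewrite ltnn.
Qed.

Lemma closing_inj u u' : flat u -> flat_root u = u -> flat u' -> flat_root u' = u' ->
  closing u = closing u' -> u = u'.
Proof.
move=> fu ru fu' ru' E; rewrite -ru; apply: (closing_root e_sym conn deg2) => //.
by rewrite -E !inE eqxx.
Qed.

(** A closing edge determines its root, so only the mates of that root compete. *)
Lemma few_component f c : obeys (edge_rank f) c -> few s.-1 (component_rule f c).
Proof.
move=> ok; case: (classic (exists u, [/\ flat u, flat_root u = u & f = closing u])); last first.
  by move=> no; apply: few0 => a [x [x' [fx rx fE _]]]; apply: no; exists x.
case=> u [fu ru fE]; have [eus dus] := side_nbrP e_sym conn deg2 fu.
apply: (few_mates (f := f) (w := u) (c := c) (P := fun x' a => forall b,
   #|[set g in component_edges u | earlier g f && (c g == b)]| + (a == b)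
          = #|[set g in component_edges x' | c g == b]|)) => //.
- exact: flat_neq_root fu.
- by move=> z za; rewrite fE; apply: earlier_side.
- by move=> z a b; exact: count_shift_inj.
move=> a [x [x' [fx rx fE' [/and3P[mx _ _] _ H]]]]; exists x' => //.
  by rewrite (closing_inj fu ru fx rx) // -fE.
by move=> b; rewrite -H (closing_inj fu ru fx rx) // -fE.
Qed.

(** The farther end of such an edge would be the side neighbor of the root; it is marked, hence has
    no mate in its component. So the side and component rules never add up on one edge. *)
Lemma closing_no_side f c a : obeys (edge_rank f) c -> is_closing f -> ~ side_rule f c a.
Proof.
move=> ok /existsP[u /and3P[fu /eqP ru /eqP fE]] [x [y [x' [fE' yx ltD [mt yx' eqD ea _]]]]].
have /and3P[fy fx eyx] := yx; have /and3P[_ fx' eyx'] := yx'.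
have y_in : y \in closing u by rewrite -fE fE' !inE eqxx.
have x_in : x \in closing u by rewrite -fE fE' !inE eqxx orbT.
have ry := closing_root e_sym conn deg2 fu ru y_in fy.
have rx := closing_root e_sym conn deg2 fu ru x_in fx.
have nyx : y != x by apply: contraTneq eyx => ->; rewrite e_irr.
have xs : x = side_nbr u.
  move: x_in; rewrite !inE => /orP[/eqP xu|/eqP //].
  by move: ltD; rewrite /flat_depth ry rx xu dist0.
have /and3P[/and3P[nx tw /eqP cx] e1 e2] := mt.
have mx : marked x by rewrite /marked (flat_lone fx) fx rx -xs eqxx orbT.
have xx' : connect flat_adj x x'.
  by apply: connect_trans (connect1 yx'); rewrite flat_csym // connect1.
have sep : separated x x' by rewrite /separated nx tw mx fx fx' xx' implybT.
have := obeys_separated ok (flat_neq_root fx) sep e2 e1.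
by rewrite cx eqxx.
Qed.

(** Except on zero edges, which may take 0, at most [s + 4] colors are forbidden: [1 + (s + 3)] on
    an upward edge and [1 + 2 + 2 + (s - 1)] inside a level, the 1 standing for color 0. *)
Lemma rule_choice f c :
  (forall g, edge_rank g < edge_rank f -> c g < s + 5 /\ ~ rule g c (c g)) ->
  exists2 a, a < s + 5 & ~ rule f c a.
Proof.
move=> H; have ok : obeys (edge_rank f) c by move=> g /H[].
have N_gt0 : 0 < s + 5 by rewrite addnS.
case: (boolP (f \in edges e)) => [fe|/negP nfe]; last by exists 0 => // -[].
case: (boolP (zero_edge f)) => [z|nz]; first by exists 0 => // -[_ []] [] //; rewrite z.
apply: (@few_avoid (s + 4)); last by rewrite ltn_add2l.
have few_zero : few 1 (fun a => a = 0) by apply: (@few_seq _ [:: 0]) => // a ->; rewrite inE.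
have s_pos : s = s.-1.+1 by case: (s) s_gt1.
have [x [y [exy fE]]] := edgesP _ _ fe.
have few_up v w : w \in above v -> f = [set v; w] -> few (s + 4) (rule f c).
  move=> wv E; have few_ab := few_above wv; rewrite -E in few_ab.
  apply: (few_sub _ _ (few_or few_zero (few_ab c ok))); first by (clear; lia).
  move=> a [_ [[z _]|[_ [K|K|K|K]]]]; rewrite ?z in nz; auto => //.
  by move: K; rewrite E => /(above_no_side wv).
case: (adjP r e_sym conn exy) => [yx|xy|dxy].
- exact: few_up yx fE.
- by apply: few_up xy _; rewrite fE set2C.
have xf : f \in incident e x by rewrite fE mem_incident.
have yf : f \in incident e y by rewrite fE set2C mem_incident // e_sym.
have few_cl : few s.-1 (fun a => side_rule f c a \/ component_rule f c a).
  case: (boolP (is_closing f)) => cl.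
    apply: few_sub (few_component ok) => // a [] //.
    by move=> /(closing_no_side ok cl).
  apply: few_sub (few_side ok) => // a [] // [u [x' [fu ru fE' _]]].
  by case/existsP: cl; exists u; rewrite fu ru fE' !eqxx.
apply: (few_sub _ _ (few_or few_zero (few_or (few_maj2 c xf) (few_or (few_maj2 c yf) few_cl)))).
  by (clear -s_pos; lia).
move=> a [_ [[z _]|[_ [K|K|K|K]]]]; rewrite ?z in nz; auto => //.
  by case: K => u; rewrite fE !inE => /orP[]/eqP-> ?; auto.
by case: K => v [w [E wv _]]; case: (above_not_side wv exy dxy); rewrite -E fE.
Qed.

Lemma exists_coloring : exists c : coloring, forall f, c f < s + 5 /\ ~ rule f c (c f).
Proof.
by apply: greedy_coloring (@edge_rank_inj _ e r) rule_local rule_choice.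
Qed.

(** * The finished coloring: majority, and mates told apart *)

Variable c : coloring.
Hypothesis c_rule : forall f, ~ rule f c (c f).

Let rank_bound := (\max_f edge_rank f).+1.

Lemma edge_rank_bound f : edge_rank f < rank_bound.
Proof. by rewrite ltnS leq_bigmax. Qed.
#[local] Hint Resolve edge_rank_bound : core.

Lemma c_obeys : obeys rank_bound c.
Proof. by move=> g _; exact: c_rule. Qed.

Lemma c_zero f : f \in edges e -> (c f == 0) = zero_edge f.
Proof. by move=> fe; exact: (obeys_zero c_obeys). Qed.

Lemma c_separated w w' : w != r -> separated w w' ->
  c [set par1 w; w] != c [set par1 w; w'].
Proof. by move=> nwr sep; exact: (obeys_separated c_obeys). Qed.

Lemma mem_zero_edge f : zero_edge f -> r \in f.
Proof. by move=> /orP[]/eqP->; rewrite !inE eqxx. Qed.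

(** Color 0 occurs at most twice at [r], of degree at least four, and at most once elsewhere. For
    another color, the last edge of that color at [u] obeys the majority rule. *)
Lemma c_majority : majority e c.
Proof.
move=> u a; set A := [set f in incident e u | c f == a]; rewrite -[#|incident e u|]/(degree e u).
have Ai f : f \in A -> f \in incident e u by rewrite inE => /andP[].
have Ac f : f \in A -> c f = a by rewrite inE => /andP[_ /eqP].
have [a0|na] := eqVneq a 0.
  have Az f : f \in A -> zero_edge f.
    by move=> fA; rewrite -c_zero ?(incident_edge (Ai _ fA)) // Ac // a0.
  have [ur|nur] := eqVneq u r.
    apply: (@leq_trans 4); last by rewrite ur.
    rewrite (leq_mul2l 2 _ 2) /=; apply: (@leq_trans #|[set [set r; y1]; [set r; y2]]|).
      by apply/subset_leq_card/subsetP => f /Az /orP[]/eqP->; rewrite !inE eqxx ?orbT.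
    by rewrite cards2; case: eqP.
  apply: leq_trans (deg2 u); rewrite (leq_mul2l 2 _ 1) /= -(cards1 [set u; r]).
  apply/subset_leq_card/subsetP => f fA; have := mem_zero_edge (Az f fA).
  have [x _ ->] := incidentP e_sym _ _ (Ai f fA).
  rewrite in_set1 in_set2 => /orP[/eqP ru|/eqP <- //].
  by rewrite ru eqxx in nur.
have [A0|[f0 f0A]] := set_0Vmem A; first by rewrite A0 cards0.
case: (arg_maxnP edge_rank f0A) => f; rewrite -[_ f]/(f \in A) => fA maxf.
have fe := incident_edge (Ai _ fA).
have nz : ~~ zero_edge f by rewrite -c_zero // Ac.
have : #|[set g in lower u f | c g == c f]| < (degree e u)./2.
  rewrite ltnNge; apply/negP => le; apply: (c_rule (f := f)); split=> //; right; split=> //.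
  by apply: Or42; exists u => //; have := Ai _ fA; rewrite inE => /andP[].
have le : #|A| <= (#|[set g in lower u f | c g == c f]|).+1.
  rewrite (cardsD1 f) fA add1n ltnS; apply/subset_leq_card/subsetP => g.
  rewrite in_setD1 => /andP[ngf gA]; rewrite inE (Ac g gA) (Ac f fA) eqxx andbT inE Ai //=.
  have /= le_gf := maxf _ gA.
  by rewrite /earlier ltn_neqAle le_gf andbT (inj_eq (@edge_rank_inj _ e r)).
move=> lt; have := odd_double_half (degree e u); rewrite -mul2n => <-.
by apply: leq_trans (leq_addl _ _); rewrite leq_mul2l /= (leq_trans le).
Qed.

Lemma mate_sym w w' : mate c w w' -> mate c w' w.
Proof.
case/and3P => nw /eqP tw /eqP cw; rewrite /mate eq_sym nw tw eqxx /=.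
by rewrite (par1_twin tw) cw.
Qed.

Lemma mate_earlier w w' v x : lone w -> mate c w w' -> rho (par1 w) < rho v ->
  x \in above v -> mate_before [set v; x] c w w'.
Proof.
move=> lw mt lt xv; have pw := above_par1 conn (lone_neq_root lw).
have /and3P[_ /eqP tw _] := mt.
by rewrite /mate_before mt !earlier_above // (above_twin tw).
Qed.

Lemma c_twins w w' : w != r -> ~~ lone w -> mate c w w' ->
  c [set par2 w; w] <> c [set par2 w; w'].
Proof.
suff main u u' : u != r -> ~~ lone u -> mate c u u' ->
    earlier [set par2 u; u'] [set par2 u; u] -> c [set par2 u; u] <> c [set par2 u; u'].
  move=> nwr nlone mt; have /and3P[nw /eqP tw _] := mt.
  have nE : [set par2 w; w'] != [set par2 w; w].
    by apply: contraNneq nw => /set2_inj ->.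
  case/orP: (earlier_total e r nE) => ea; first exact: main.
  move/esym; have := main w' w; rewrite (par2_twin tw) (lone_twin tw); apply=> //.
    by apply: (above_neq_root (v := par1 w)); apply: above_twin tw _; exact: (above_par1 conn).
  exact: mate_sym.
move=> nur nlone mt ea; have /and3P[nu /eqP tw _] := mt.
have [p2u np2 _] := par2P conn nur nlone; have [p1u minp1] := par1P conn nur.
have ua : u \in above (par2 u) by rewrite mem_above.
have ua1 := above_par1 conn nur.
have lt12 : rho (par1 u) < rho (par2 u).
  by rewrite ltn_neqAle minp1 // andbT (inj_eq (@bfs_rank_inj _ e r)) eq_sym.
(* Were the second parent [r], the first, lying in the same level, would be [r] too. *)
have nz : ~~ zero_edge [set par2 u; u].
  apply/negP => /(zero_edge_above ua)[p2r _]; have := above_depth ua1.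
  rewrite (above_depth ua) p2r depth_root => -[] /esym/(depth_eq0 conn) p1r.
  by rewrite p1r p2r eqxx in np2.
move=> E; apply: (obeys_above c_obeys ua _ nz) => //; apply: Or43; split=> //.
exists u'; split=> //; rewrite /mate_before mt !earlier_above //.
exact: above_twin tw _.
Qed.

(** The last edge to complete the two palettes is a star edge; by symmetry it belongs to [u], and
    the palette rule applies there. *)
Lemma c_palettes v v' : lone v -> mate c v v' -> above v != set0 -> above v' != set0 ->
  ~ forall b, #|[set x in above v | c [set v; x] == b]|
            = #|[set x in above v' | c [set v'; x] == b]|.
Proof.
suff main u u' : lone u -> mate c u u' -> above u != set0 -> above u' != set0 ->
    earlier [set u'; star u'] [set u; star u] ->
    ~ forall b, #|[set x in above u | c [set u; x] == b]|
            = #|[set x in above u' | c [set u'; x] == b]|.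
  move=> lv mt av av' E; have /and3P[nv /eqP tw _] := mt.
  have nE : [set v'; star v'] != [set v; star v].
    apply: contraNneq nv => /(above_pair_inj (star_above av') (star_above av))[-> _] //.
  case/orP: (earlier_total e r nE) => ea; first exact: (main _ _ lv mt).
  by apply: (main v' v) => //; [rewrite (lone_twin tw) | exact: mate_sym].
move=> lu mt au au' ea E; have nur := lone_neq_root lu.
have su := star_above au; have /and3P[nu /eqP tw _] := mt.
have nz : ~~ zero_edge [set u; star u].
  by apply/negP => /(zero_edge_above su)[ur _]; rewrite ur eqxx in nur.
apply: (obeys_above c_obeys su _ nz) => //; apply: Or44; split=> //.
exists u'; split=> //.
- by apply: mate_earlier su => //; apply: bfs_rank_above; exact: above_par1.
- move=> x xu'; have [->//|nx] := eqVneq x (star u').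
  exact: ltn_trans (earlier_star xu' nx) ea.
move=> b; rewrite -E [RHS](cardsD1 (star u)) inE su /= eq_sym addnC; congr (_ + _).
apply: eq_card => x; rewrite in_setD1 !(inE, in_set).
case: (boolP (x \in above u)) => xu; last first.
  by move: xu; rewrite inE => /negPf ->; rewrite andbF.
have [->|nx] := eqVneq x (star u); first by rewrite /earlier ltnn andbF.
by rewrite earlier_star.
Qed.

(** A component meets only the closing edge of its own root; once that is colored, all its edges
    are. *)
Lemma component_closing x g : flat x -> g \in component_edges x -> is_closing g ->
  g = closing (flat_root x).
Proof.
move=> fx; rewrite inE => /andP[_ /existsP[y /andP[yg xy]]].
case/existsP => w /and3P[fw /eqP rw /eqP gE].
have yw : flat_root y = w.
  by apply: (closing_root e_sym conn deg2 fw rw); rewrite -?gE //; exact: connect_flat xy.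
by rewrite gE -yw; congr closing; apply/eqP; rewrite flat_root_eq // flat_csym.
Qed.

Lemma c_components u x' : flat u -> flat_root u = u -> mate c u x' -> flat x' ->
  earlier (closing (flat_root x')) (closing u) ->
  ~ forall b, #|[set g in component_edges u | c g == b]|
            = #|[set g in component_edges x' | c g == b]|.
Proof.
move=> fu ru mt fx' ea E; have [eus dus] := side_nbrP e_sym conn deg2 fu.
have nur := flat_neq_root fu; have pu := above_par1 conn nur.
have /and3P[nu /eqP tw _] := mt.
have fe : closing u \in edges e by exact: mem_edges.
have ue : closing u \in component_edges u.
  by rewrite inE fe; apply/existsP; exists u; rewrite !inE eqxx /=.
apply: (c_rule (f := closing u)); split=> //; right; split; first exact: zero_edge_side.
apply: Or44; right; exists u, x'; split=> //; split.
- by rewrite /mate_before mt !earlier_side // (above_twin tw).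
- move=> g gx'; have ge : g \in edges e by move: gx'; rewrite inE => /andP[].
  case: (boolP (is_closing g)) => [cl|ncl]; last exact: earlier_closing.
  by rewrite (component_closing fx' gx' cl).
move=> b; rewrite -E [RHS](cardsD1 (closing u)) [closing u \in _]inE ue /= addnC.
congr (_ + _); apply: eq_card => g; rewrite in_setD1 [LHS]in_set [in RHS]in_set.
have [gu|] := boolP (g \in component_edges u); last by rewrite andbF.
have ge : g \in edges e by move: gu; rewrite inE => /andP[].
have [->|ng] := eqVneq g (closing u); first by rewrite /earlier ltnn.
rewrite earlier_closing //; apply: contra ng => cl.
by rewrite (component_closing fu gu cl) ru.
Qed.

(** * Automorphisms preserving the coloring *)

Definition colored_aut (phi : {perm T}) : Prop :=
  automorphism e phi /\ forall u v, e u v -> c [set phi u; phi v] = c [set u; v].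

Lemma colored_aut_inv phi : colored_aut phi -> colored_aut (phi^-1)%g.
Proof.
move=> [aut col]; split=> [u v|u v euv]; first by rewrite -aut !permKV.
by rewrite -col ?permKV // -aut !permKV.
Qed.

(** Zero edges go to zero edges, which contain [r]; if [r] moved, both [y1] and [y2] would be sent
    to [r]. *)
Lemma colored_aut_root phi : colored_aut phi -> phi r = r.
Proof.
move=> [aut col]; apply/eqP; apply: contraT => nr.
have img y : e r y -> zero_edge [set r; y] -> phi y = r.
  move=> ry z; have : zero_edge [set phi r; phi y].
    by rewrite -c_zero ?mem_edges ?aut // col // c_zero ?mem_edges.
  by move=> /mem_zero_edge; rewrite !inE => /orP[/eqP E|/eqP //]; rewrite -E eqxx in nr.
have E1 : phi y1 = r by apply: img; rewrite // /zero_edge eqxx.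
have E2 : phi y2 = r by apply: img; rewrite // /zero_edge eqxx orbT.
by move: ny12; rewrite -(inj_eq (@perm_inj _ phi)) E1 E2 eqxx.
Qed.

Section Automorphism.

Variable phi : {perm T}.
Hypothesis phi_aut : colored_aut phi.

Let aut : automorphism e phi := proj1 phi_aut.
Let col := proj2 phi_aut.

Lemma aut_depth x : d (phi x) = d x.
Proof. by rewrite /d -{1}(colored_aut_root phi_aut) dist_perm. Qed.

Lemma aut_mem_below v w : (phi v \in below (phi w)) = (v \in below w).
Proof. by rewrite !inE aut !aut_depth. Qed.

Lemma aut_mem_above v w : (phi w \in above (phi v)) = (w \in above v).
Proof. by rewrite !inE aut !aut_depth. Qed.

Lemma aut_below w : below (phi w) = phi @: below w.
Proof.
apply/setP => v; rewrite -[v](permKV phi) aut_mem_below mem_imset //; exact: perm_inj.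
Qed.

Lemma aut_above w : above (phi w) = phi @: above w.
Proof.
apply/setP => v; rewrite -[v](permKV phi) aut_mem_above mem_imset //; exact: perm_inj.
Qed.

Lemma aut_flat x : flat (phi x) = flat x.
Proof.
rewrite /flat /lone aut_below aut_above card_imset; last exact: perm_inj.
by rewrite -!cards_eq0 card_imset //; exact: perm_inj.
Qed.

Lemma aut_flat_adj x y : flat_adj (phi x) (phi y) = flat_adj x y.
Proof. by rewrite /flat_adj /= !aut_flat aut. Qed.

Lemma aut_palette v b : #|[set x in above (phi v) | c [set phi v; x] == b]|
  = #|[set x in above v | c [set v; x] == b]|.
Proof.
rewrite -[RHS](card_imset _ (@perm_inj _ phi)); apply: eq_card => x.
rewrite -[x](permKV phi) mem_imset; last exact: perm_inj.
rewrite [LHS]in_set [RHS]in_set aut_mem_above; case: (boolP (_ \in above v)) => //= xv.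
by rewrite col //; exact: above_adj xv.
Qed.

Lemma aut_component_edges x f : f \in edges e ->
  (phi @: f \in component_edges (phi x)) = (f \in component_edges x).
Proof.
case/edgesP => u [v [euv ->]]; rewrite imsetU1 imset_set1 2!in_set !mem_edgesE // aut euv /=.
have E w : connect flat_adj (phi x) (phi w) = connect flat_adj x w.
  exact: connect_perm aut_flat_adj.
apply/existsP/existsP => -[y]; rewrite in_set2 => /andP[/orP[]/eqP-> xy].
- by exists u; rewrite in_set2 eqxx -E.
- by exists v; rewrite in_set2 eqxx orbT -E.
- by exists (phi u); rewrite in_set2 eqxx E.
- by exists (phi v); rewrite in_set2 eqxx orbT E.
Qed.

(** The reverse inequality comes from the inverse automorphism. *)
Lemma aut_components_le x b :
  #|[set g in component_edges x | c g == b]| <= #|[set g in component_edges (phi x) | c g == b]|.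
Proof.
rewrite -[leqLHS](card_imset _ (imset_inj (@perm_inj _ phi))); apply/subset_leq_card/subsetP => f'.
case/imsetP => f; rewrite in_set => /andP[fx /eqP cf] ->; rewrite in_set.
have fe : f \in edges e by move: fx; rewrite in_set => /andP[].
rewrite aut_component_edges // fx /=; case/edgesP: fe cf => u [v [euv ->]] <-.
by rewrite imsetU1 imset_set1 col.
Qed.

End Automorphism.

(** The lower neighbors are fixed, so the image is a twin and its first downward edge has the same
    color. *)
Lemma aut_mate phi x : colored_aut phi -> x != r ->
  (forall y, d y < d x -> phi y = y) -> phi x = x \/ mate c x (phi x).
Proof.
move=> pa nxr fix_low; have [|nx] := eqVneq (phi x) x; first by left.
right; have pE v : v \in below x -> phi v = v.
  by rewrite inE => /andP[_ /eqP dv]; apply: fix_low; rewrite -dv.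
rewrite /mate nx /=; apply/andP; split.
  by rewrite (aut_below pa); apply/eqP; rewrite -[RHS]imset_id; exact: eq_in_imset.
have [px _] := par1P conn nxr; rewrite -{1}(pE _ px) (proj2 pa) //.
by move: px; rewrite inE => /andP[].
Qed.

(** Matching components have equal palettes, which the component rule excludes at the later closing
    edge. Being one-sided, this is applied to [phi] and to its inverse. *)
Lemma aut_closing phi u : colored_aut phi -> flat u -> flat_root u = u ->
  (forall y, d y < d u -> phi y = y) -> flat_root (phi u) != u ->
  ~~ earlier (closing (flat_root (phi u))) (closing u).
Proof.
move=> pa fu ru fix_low nu; apply/negP => ea.
have [E|mt] := aut_mate pa (flat_neq_root fu) fix_low; first by rewrite E ru eqxx in nu.
apply: (c_components fu ru mt _ ea); first by rewrite (aut_flat pa).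
move=> b; apply/eqP; rewrite eqn_leq aut_components_le //=.
by have := aut_components_le (colored_aut_inv pa) (phi u) b; rewrite permK.
Qed.

Lemma c_side y x x' : flat_adj y x -> flat_adj y x' -> flat_depth y < flat_depth x ->
  flat_depth x' = flat_depth x -> mate c x x' -> c [set y; x] <> c [set y; x'].
Proof.
suff main z z' : flat_adj y z -> flat_adj y z' -> flat_depth y < flat_depth z ->
    flat_depth z' = flat_depth z -> mate c z z' ->
    earlier [set y; z'] [set y; z] -> c [set y; z] <> c [set y; z'].
  move=> yx yx' lt eqD mt; have /and3P[nx _ _] := mt.
  have nE : [set y; x'] != [set y; x] by apply: contraNneq nx => /set2_inj ->.
  case/orP: (earlier_total e r nE) => ea; first exact: main.
  by move/esym; apply: main => //; [rewrite eqD | exact: mate_sym].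
move=> yz yz' lt eqD mt ea E; have /and3P[fy fz eyz] := yz.
have /and3P[nz /eqP tw _] := mt; have dyz := flat_adj_depth e_sym conn yz.
have pz := above_par1 conn (flat_neq_root fz).
apply: (c_rule (f := [set y; z])); split; first exact: mem_edges.
right; split; first exact: zero_edge_side.
apply: Or44; left; exists z, y, z'; split=> //; split=> //.
by rewrite /mate_before mt !earlier_side // (above_twin tw).
Qed.

(** The palettes show that the component of [u] is mapped to itself; there the marked [u] is
    separated from every other twin. *)
Lemma aut_flat_root phi u : colored_aut phi -> flat u -> flat_root u = u ->
  (forall y, d y < d u -> phi y = y) -> phi u = u.
Proof.
move=> pa fu ru fix_low; have ia := colored_aut_inv pa.
have conn_phi x y : connect flat_adj (phi x) (phi y) = connect flat_adj x y.
  exact: connect_perm (aut_flat_adj pa).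
have fphi : flat (phi u) by rewrite (aut_flat pa).
set u' := flat_root (phi u).
have uu' : connect flat_adj (phi u) u' by exact: flat_rootP.
have ru' : u' = u.
  apply/eqP; apply: contraT => nu.
  have fu' : flat u' by exact: connect_flat uu'.
  have inv_root : flat_root ((phi^-1)%g u') = u.
    by rewrite -[RHS]ru; apply/eqP; rewrite flat_root_eq // flat_csym // -conn_phi permKV.
  have nE : closing u' != closing u.
    by apply: contraNneq nu => /(closing_inj fu' (flat_rootK r e_sym _) fu ru) ->.
  case/orP: (earlier_total e r nE) => ea.
    by have := aut_closing pa fu ru fix_low nu; rewrite ea.
  have := aut_closing ia fu' (flat_rootK r e_sym _); rewrite inv_root ea eq_sym; apply=> //.
  move=> y; rewrite -(connect_flat_depth e_sym conn uu') (aut_depth pa) => /fix_low yE.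
  by rewrite -{1}yE permK.
have [//|mt] := aut_mate pa (flat_neq_root fu) fix_low.
have /and3P[nu tw /eqP cu] := mt.
have sep : separated u (phi u).
  rewrite /separated nu tw (flat_lone fu) fu fphi /= flat_csym //.
  by rewrite -{2}ru' uu' /= /marked (flat_lone fu) fu ru eqxx.
by have := c_separated (flat_neq_root fu) sep; rewrite cu eqxx.
Qed.

(** Induction on the distance from the fixed root: a moved [y] would go to a mate at the same depth
    with the same fixed neighbor [z], against the side rule. *)
Lemma aut_flat_fix phi x : colored_aut phi -> flat x ->
  (forall y, d y < d x -> phi y = y) -> phi x = x.
Proof.
move=> pa fx fix_low; set u := flat_root x.
have ux : connect flat_adj u x by rewrite flat_csym //; exact: flat_rootP.
have fu : flat u by exact: flat_flat_root.
have dE y : connect flat_adj u y -> d y = d x.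
  by move=> uy; rewrite -(connect_flat_depth e_sym conn uy) (connect_flat_depth e_sym conn ux).
have rE y : connect flat_adj u y -> flat_root y = u.
  by rewrite flat_csym // -flat_root_eq // => /eqP ->; exact: flat_rootK.
have pu : phi u = u.
  by apply: aut_flat_root => //; [exact: flat_rootK | rewrite (dE u)].
have [n le_n] := ubnP (flat_depth x).
have main y : flat_depth y < n -> connect flat_adj u y -> phi y = y.
  elim: n {le_n} y => // n IHn y lt_y uy.
  have [->//|nyu] := eqVneq y u.
  have [z [uz zy dy]] := dist_pred uy nyu.
  have lt_zy : flat_depth z < flat_depth y by rewrite /flat_depth !rE // dy.
  have pz : phi z = z by apply: IHn => //; exact: leq_trans lt_zy _.
  have fy := connect_flat fu uy.
  have fix_y t : d t < d y -> phi t = t by rewrite (dE y uy); exact: fix_low.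
  have [//|mt] := aut_mate pa (flat_neq_root fy) fix_y.
  have uy' : connect flat_adj u (phi y).
    by rewrite -pu connect_perm //; exact: aut_flat_adj pa.
  have zy' : flat_adj z (phi y) by rewrite -pz (aut_flat_adj pa).
  have eqD : flat_depth (phi y) = flat_depth y.
    by rewrite /flat_depth !rE // -{1}pu dist_perm //; exact: aut_flat_adj pa.
  case: (c_side zy zy' lt_zy eqD mt); rewrite -{2}pz (proj2 pa) //.
  by case/and3P: zy.
exact: main.
Qed.

Lemma aut_fix phi n x : colored_aut phi -> d x < n -> phi x = x.
Proof.
move=> pa; elim: n x => // n IHn x lt_xn.
have fix_low y : d y < d x -> phi y = y.
  by move=> lt; apply: IHn; exact: leq_trans lt _.
have [->|nxr] := eqVneq x r; first exact: colored_aut_root.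
have [//|mt] := aut_mate pa nxr fix_low.
case: (boolP (lone x)) => [lx|nlx]; last first.
  have [p2x _ _] := par2P conn nxr nlx; move: p2x; rewrite inE => /andP[ep /eqP dp].
  case: (c_twins nxr nlx mt); rewrite -{2}(fix_low (par2 x)) ?(proj2 pa) //.
  by rewrite -dp.
have [ax|nax] := eqVneq (above x) set0.
  by apply: aut_flat_fix => //; rewrite /flat lx ax eqxx.
case: (c_palettes lx mt nax) => [|b]; last by rewrite (aut_palette pa).
by move: nax; rewrite (aut_above pa) -!cards_eq0 card_imset //; exact: perm_inj.
Qed.

Lemma c_distinguishing : distinguishing e c.
Proof.
move=> phi aut col; apply/permP => x; rewrite perm1.
by apply: (aut_fix (n := (d x).+1)).
Qed.

End Coloring.

(** * Graphs with a vertex of degree at least four *)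

Lemma MD_colorable_large (T : finType) (e : rel T) (r : T) (s : nat) :
  symmetric e -> irreflexive e -> (forall x y, connect e x y) ->
  (forall u, 2 <= degree e u) -> (forall u, degree e u <= s * s) ->
  4 <= degree e r -> 1 < s -> MD_colorable e (s + 5).
Proof.
move=> e_sym e_irr conn deg2 deg_le deg_r s_gt1.
have [y1 [y2 [ry1 ry2 ny nsep]]] : exists y1 y2,
    [/\ e r y1, e r y2, y1 != y2 & ~~ separated e r y1 y2].
  (* Suppose all neighbors of [r] are pairwise separated. Take an unmarked one if there is any: the
     others are then marked in either case, hence among the two candidates of [marked_separated],
     and [r] has at most three neighbors. *)
  apply: NNPP => no.
  have sep x y : e r x -> e r y -> x != y -> separated e r x y.
    by move=> rx ry nxy; apply: contraT => ns; case: no; exists x, y.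
  have bound x0 (l : seq T) : (forall x, e r x -> x \in x0 :: l) -> size l <= 2 -> False.
    move=> sub sz; move: deg_r; rewrite degreeE // leqNgt; case/negP.
    apply: leq_ltn_trans (_ : size (x0 :: l) < 4); last by [].
    apply: leq_trans (card_size _); apply/subset_leq_card/subsetP => x.
    by rewrite inE => /sub.
  have [x0 rx0] : exists x, e r x.
    have : 0 < degree e r by exact: leq_trans deg_r.
    by rewrite degreeE // => /card_gt0P[x]; rewrite inE; exists x.
  pose l x := [:: if lone e r x then flat_root e r x else twin_rep e r x;
                 side_nbr e r (flat_root e r x)].
  case: (classic (exists2 x, e r x & ~~ marked e r x)) => [[x rx nmx]|all_m].
    apply: (@bound x (l x)) => // y ry; rewrite inE; case: eqVneq => //= nyx.
    have s_xy := sep x y rx ry; rewrite eq_sym in s_xy.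
    apply: (marked_separated e_sym (s_xy nyx)).
    by have /and4P[_ _ _] := s_xy nyx; rewrite (negPf nmx).
  have mk x : e r x -> marked e r x by move=> rx; apply: contraT => nm; case: all_m; exists x.
  apply: (@bound x0 (l x0)) => // y ry; rewrite inE; case: eqVneq => //= nyx.
  by apply: (marked_separated e_sym); [apply: sep; rewrite // eq_sym | exact: mk].
have [c Hc] := exists_coloring e_sym e_irr conn deg2 deg_le deg_r s_gt1 ry1 ry2 ny nsep.
have nrule f := proj2 (Hc f).
exists c; split=> [f _||]; first by have [] := Hc f.
  exact: (c_majority e_sym deg2 deg_r nrule).
exact: (c_distinguishing e_sym e_irr conn deg2 ry1 ry2 ny nsep nrule).
Qed.

(** * Graphs of maximum degree at most three *)

Section Subcubic.

Variables (T : finType) (e : rel T) (r b z : T).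
Hypotheses (e_sym : symmetric e) (e_irr : irreflexive e).
Hypothesis conn : forall x y, connect e x y.
Hypothesis deg2 : forall u, 2 <= degree e u.
Hypothesis deg3 : forall u, degree e u <= 3.
Hypotheses (erb : e r b) (ebz : e b z) (nzr : z != r).

Let h := [set b; z].
Let zf := [set r; b].

(** The edge [h] comes last: incident with [b] but not with [r], it can still make their palettes
    differ. *)
Definition subcubic_rank (f : {set T}) : nat := (f == h) * #|{set T}| + enum_rank f.
Local Notation lt g f := (subcubic_rank g < subcubic_rank f).

Definition proper_rule (f : {set T}) (c : {set T} -> nat) (a : nat) : Prop :=
  exists2 u, u \in f & exists2 g, g \in incident e u & lt g f /\ a = c g.
Definition palette_of (c : {set T} -> nat) (A : {set {set T}}) (x : nat) : nat :=
  #|[set g in A | c g == x]|.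
Definition subcubic_rule (f : {set T}) (c : {set T} -> nat) (a : nat) : Prop :=
  f \in edges e /\
  ((f = zf /\ a <> 0) \/
   (f <> zf /\ [\/ a = 0, proper_rule f c a |
      f = h /\ forall x, palette_of c (incident e b :\ h) x + (a == x)
                         = palette_of c (incident e r) x])).

Lemma subcubic_rank_inj : injective subcubic_rank.
Proof.
move=> f g; rewrite /subcubic_rank => /(congr1 (modn^~ #|{set T}|)).
by rewrite /= !modnMDl !modn_small ?ltn_ord // => /val_inj/enum_rank_inj.
Qed.

Lemma subcubic_rank_last g : g != h -> lt g h.
Proof.
move=> /negPf ng; rewrite /subcubic_rank ng eqxx mul0n mul1n add0n.
exact: leq_trans (ltn_ord _) (leq_addr _ _).
Qed.

Lemma last_edge_notin : h \notin incident e r.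
Proof.
rewrite inE negb_and in_set2 negb_or (eq_sym r z) nzr andbT; apply/orP; right.
by apply: contraTneq erb => ->; rewrite e_irr.
Qed.

Lemma subcubic_rule_local f c c' a :
  (forall g, lt g f -> c g = c' g) -> subcubic_rule f c a -> subcubic_rule f c' a.
Proof.
move=> E [fe [H|[nf H]]]; split=> //; first by left.
right; split=> //; case: H => [->|[u uf [g gu [ltg ->]]]|[fh H]].
- exact: Or31.
- by apply: Or32; exists u => //; exists g => //; rewrite -E.
apply: Or33; split=> // x; move: E; rewrite fh => E; have := H x; rewrite /palette_of.
rewrite (eq_card_in (Q := fun g => c' g == x)) => [->|g]; last first.
  by rewrite in_setD1 => /andP[/subcubic_rank_last/E -> _].
apply: eq_card_in => g gr; rewrite E // subcubic_rank_last //.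
by apply: contraTneq gr => ->; exact: last_edge_notin.
Qed.

(** Color 0, two other edges at each end and the palette condition forbid at most [1 + 2 + 2 + 1]
    colors, fewer than [s + 5]. *)
Lemma subcubic_choice s f c : 1 < s ->
  exists2 a, a < s + 5 & ~ subcubic_rule f c a.
Proof.
move=> s_gt1; have N_gt0 : 0 < s + 5 by rewrite addnS.
case: (boolP (f \in edges e)) => [fe|/negP nfe]; last by exists 0 => // -[].
have [fz|/eqP nz] := eqVneq f zf; first by exists 0 => // -[_ []] [].
apply: (@few_avoid 6); last by rewrite (ltn_add2r 5 1).
have [x [y [exy fE]]] := edgesP _ _ fe.
have few_u u : f \in incident e u ->
    few 2 (fun a => exists2 g, g \in incident e u & lt g f /\ a = c g).
  move=> fu; apply: (few_sub (leqnn _)) (few_image (X := incident e u :\ f)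
      (P := fun g a => a = c g) (k := 2) _ _).
  - move=> a [g gu [ltg ->]]; exists g => //; rewrite in_setD1 gu andbT.
    by apply: contraTneq ltg => ->; rewrite ltnn.
  - by have := deg3 u; rewrite /degree (cardsD1 f) fu.
  - by move=> g a1 a2 -> ->.
have xf : f \in incident e x by rewrite fE mem_incident.
have yf : f \in incident e y by rewrite fE set2C mem_incident // e_sym.
have few0' : few 1 (fun a => a = 0) by apply: (@few_seq _ [:: 0]) => // a ->; rewrite inE.
have fewh : few 1 (fun a => forall x, palette_of c (incident e b :\ h) x + (a == x)
                         = palette_of c (incident e r) x).
  (* A singleton index set expresses that the condition names at most one color. *)
  apply: (few_sub (leqnn _)) (few_image (X := [set r]) (P := fun _ a =>
    forall x, palette_of c (incident e b :\ h) x + (a == x)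
                         = palette_of c (incident e r) x) (k := 1) _ _).
  - by move=> a H; exists r; rewrite ?inE.
  - by rewrite cards1.
  - by move=> _ a1 a2; exact: count_shift_inj.
apply: (few_sub _ _ (few_or few0' (few_or (few_u x xf) (few_or (few_u y yf) fewh)))) => //.
move=> a [_ [[]//|[_ [|[u]|[]]]]]; auto.
by rewrite fE in_set2 => /orP[]/eqP-> H; auto.
Qed.

Lemma MD_colorable_subcubic s : 1 < s -> MD_colorable e (s + 5).
Proof.
move=> s_gt1.
have [c Hc] := greedy_coloring subcubic_rank_inj subcubic_rule_local
  (fun f c _ => subcubic_choice f c s_gt1).
have nrule f := proj2 (Hc f).
have zfe : zf \in edges e by exact: mem_edges.
have c0 f : f \in edges e -> c f = 0 <-> f = zf.
  move=> fe; split=> [c0|fz]; apply: NNPP => nf; apply: (nrule f); split=> //.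
    by right; split=> //; apply: Or31.
  by left.
have proper u f g : f \in incident e u -> g \in incident e u -> c f = c g -> f = g.
  suff main f' g' : f' \in incident e u -> g' \in incident e u -> lt g' f' -> c f' = c g' -> False.
    move=> fu gu E; apply/eqP; apply: contraT => nfg.
    have : (lt f g) || (lt g f) by rewrite -neq_ltn (inj_eq subcubic_rank_inj).
    case/orP => l; first by case: (main g f).
    by case: (main f g).
  move=> fu gu ltg E; have fe := incident_edge fu; have ge := incident_edge gu.
  apply: (nrule f'); split=> //; right; split.
    move=> fz; have : g' = zf by apply/(c0 _ ge); rewrite -E; apply/(c0 _ fe).
    by move=> gz; move: ltg; rewrite fz gz ltnn.
  apply: Or32; exists u; first by move: fu; rewrite inE => /andP[].
  by exists g'.
exists c; split=> [f _||]; first by have [] := Hc f.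
  move=> u a; apply: leq_trans (deg2 u); rewrite (leq_mul2l 2 _ 1) /=.
  apply/card_le1_eqP => f g; rewrite !in_set => /andP[fu /eqP cf] /andP[gu /eqP cg].
  by apply: (proper u); rewrite ?in_set // cf cg.
move=> phi aut col.
have palE u x : palette_of c (incident e (phi u)) x = palette_of c (incident e u) x.
  have E v : palette_of c (incident e v) x = #|[set y | e v y & c [set v; y] == x]|.
    rewrite /palette_of -[RHS](card_imset _ (@set2_inj _ v)); apply: eq_card => g.
    rewrite in_set; apply/andP/imsetP => [[/(incidentP e_sym)[y evy ->] cy]|[y]].
      by exists y; rewrite // inE evy.
    by rewrite inE => /andP[evy cy ->]; rewrite mem_incident.
  rewrite !E -[RHS](card_imset _ (@perm_inj _ phi)); apply: eq_card => y.
  rewrite -[y](permKV phi) mem_imset; last exact: perm_inj.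
  by rewrite !inE aut; case: (boolP (e u _)) => //= /col ->.
have zphi : [set phi r; phi b] = zf.
  by apply/c0; rewrite ?mem_edges ?aut // col //; apply/c0.
(* The edge [zf] is the only one of color 0, so [r] goes to [r] or [b], and the palettes exclude
   [b]. *)
have phir : phi r = r.
  have : phi r \in zf by rewrite -zphi !inE eqxx.
  rewrite in_set2 => /orP[/eqP//|/eqP rb].
  case: (nrule h); split; first exact: mem_edges.
  right; split; first by move=> hz; have := last_edge_notin; rewrite hz mem_incident.
  apply: Or33; split=> // x; rewrite -palE rb /palette_of.
  rewrite [RHS](cardsD1 h) [h \in _]in_set mem_incident //= addnC; congr (_ + _).
  by apply: eq_card => g; rewrite !inE -!andbA.
apply/permP => x; rewrite perm1.
(* Edges at a fixed vertex have distinct colors, so its neighbors are fixed too; this spreads along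
   a path from [r]. *)
case/connectP: (conn r x) => p; elim: p (r) phir => [|y p IHp] v /= phiv; first by move=> _ ->.
case/andP => evy; apply: IHp; apply: (@set2_inj _ v); apply: (proper v).
- by rewrite mem_incident // -{1}phiv aut.
- by rewrite mem_incident.
- by rewrite -{1}phiv col.
Qed.

End Subcubic.

(** * Reduction to connected graphs of minimum degree two, and conclusion *)

Lemma connectivity1 (T : finType) (e : rel T) : vertex_connectivity e = 1 ->
  (forall x y, connect e x y) /\ 1 < #|T|.
Proof.
rewrite /vertex_connectivity; case: arg_minnP => [|S _ minS S1].
  by rewrite setCT cards0 orbT.
(* Otherwise the empty set would be admissible and the minimum would be 0. *)
have : ~~ (disconnects e set0 || (#|~: (set0 : {set T})| <= 1)).
  by apply/negP => /minS; rewrite S1 cards0.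
rewrite negb_or setC0 cardsT -ltnNge => /andP[/existsP ndis ->]; split=> // x y.
apply: contraT => nxy; case: ndis; exists x; rewrite !inE /=.
apply/existsP; exists y; rewrite !inE /=; apply: contra nxy => /connect_sub; apply.
by move=> u v /and3P[_ _ euv]; exact: connect1.
Qed.

Lemma min_degree2 (T : finType) (e : rel T) :
  symmetric e -> (forall x y, connect e x y) -> 1 < #|T| ->
  (forall f : {set T}, ~~ pendant e f) -> forall u, 2 <= degree e u.
Proof.
move=> e_sym conn T_gt1 no_pendant u.
have [v nvu] : exists v, v != u.
  have : 0 < #|[set~ u]| by rewrite cardsC1; case: #|T| T_gt1 => [|[]].
  by case/card_gt0P => v; rewrite !inE; exists v.
have [x eux] : exists x, e u x.
  case/connectP: (conn u v) => -[|x p] /=; first by move=> _ vu; rewrite vu eqxx in nvu.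
  by case/andP; exists x.
have fu : [set u; x] \in incident e u by exact: mem_incident.
have deg_gt0 : 0 < degree e u by apply/card_gt0P; exists [set u; x].
rewrite ltn_neqAle deg_gt0 andbT eq_sym; apply/negP => deg1.
have := no_pendant [set u; x]; rewrite /pendant mem_edges //=; case/negP.
by apply/existsP; exists u; rewrite !inE eqxx.
Qed.

Lemma MD_colorable_connected (T : finType) (e : rel T) (s : nat) :
  symmetric e -> irreflexive e -> (forall x y, connect e x y) -> 0 < #|T| ->
  (forall u, 2 <= degree e u) -> max_degree e <= s * s -> MD_colorable e (s + 5).
Proof.
move=> e_sym e_irr conn /card_gt0P[r _] deg2 le_s.
have deg_le u : degree e u <= s * s by exact: leq_trans (degree_le_max e u) le_s.
have s_gt1 : 1 < s by move: (leq_trans (deg2 r) (deg_le r)); case: (s) => [|[]].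
case: (classic (exists r, 4 <= degree e r)) => [[r' deg_r]|deg3].
  exact: (MD_colorable_large (r := r')).
have le3 u : degree e u <= 3 by rewrite leqNgt; apply/negP => ?; case: deg3; exists u.
have [b erb] : exists b, e r b.
  have : 0 < degree e r by exact: ltnW (deg2 r).
  by rewrite degreeE // => /card_gt0P[b]; rewrite inE; exists b.
have [z] : exists z, z \in [set x | e b x] :\ r.
  apply/set0Pn; rewrite -card_gt0; have := deg2 b; rewrite degreeE // (cardsD1 r) !inE.
  by rewrite e_sym erb.
rewrite !inE => /andP[nzr ebz].
exact: (MD_colorable_subcubic e_sym e_irr conn deg2 le3 erb ebz nzr).
Qed.

(** Descent to the least number of colors, classical because colorability is a mere proposition. *)
Lemma is_MD_exists (T : finType) (e : rel T) k : MD_colorable e k ->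
  exists2 m, is_MD e m & m <= k.
Proof.
elim/ltn_ind: k => k IHk Hk.
case: (classic (exists2 j, j < k & MD_colorable e j)) => [[j lt_jk /(IHk _ lt_jk)[m Hm le_mj]]|no].
  by exists m => //; exact: leq_trans le_mj (ltnW lt_jk).
exists k => //; split=> // j Hj; rewrite leqNgt; apply/negP => lt_jk.
by case: no; exists j.
Qed.

Import Order.TTheory GRing.Theory Num.Theory.

Theorem theorem23 (R : realType) (T : finType) (e : rel T)
    (e_sym : symmetric e) (e_irr : irreflexive e)
    (conn1 : vertex_connectivity e = 1)
    (no_pendant : forall f : {set T}, ~~ pendant e f) :
  exists2 m : nat, is_MD e m &
    (m%:Z <= Num.ceil (Num.sqrt ((max_degree e)%:R : R)) + 5)%R.
Proof.
have [conn T_gt1] := connectivity1 conn1.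
have deg2 := min_degree2 e_sym conn T_gt1 no_pendant.
set x := Num.sqrt _; have x_ge0 : (0 <= x)%R by exact: sqrtr_ge0.
(* The ceiling lies in [int]; it is nonnegative, so it can serve as the number [s]. *)
have [s sE] : exists s : nat, Num.ceil x = Posz s.
  by exists `|Num.ceil x|%N; rewrite gez0_abs // ceil_ge0 (lt_le_trans _ x_ge0) // ltrN10.
have le_s : max_degree e <= s * s.
  have le_xs : (x <= s%:R)%R by have := ceil_ge x; rewrite sE.
  rewrite -(ler_nat R) natrM -expr2 -[leLHS]sqr_sqrtr ?ler0n //.
  by rewrite ler_sqr // ?nnegrE // ler0n.
have [m Hm le_m] := is_MD_exists (MD_colorable_connected e_sym e_irr conn (ltnW T_gt1) deg2 le_s).
by exists m => //; rewrite sE.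
Qed.
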